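(* Let $c$ be a $0$-convex path in $\mathbb{R}^{2}$ with nowhere vanishing centro-affine curvature. Let $\alpha :I\rightarrow \mathbb{R}^{2}$ be any parametrization of $c$ (not necessarily standard centro-affine). For each $t\in I$, let $E(t)$ be the ellipse centered at the origin osculating $\alpha$ at $t$. Then the null curve $E$ in $\mathcal{E}$ has spatial acceleration, that is, $\left\Vert \frac{D}{dt}E'(t)\right\Vert >0$ for all $t\in I$, and the $1$-form $\tau_{c}$ on $c$ is well defined (independently of the choice of the parametrization $\alpha$) by $$\alpha^{\ast }\tau_{c}=\left\Vert \frac{DE'}{dt}\right\Vert^{1/4}dt .$$ Moreover, the map $c\mapsto \tau_{c}$, defined on the set of all $0$-convex paths with nowhere vanishing centro-affine curvature, is invariant under the action of $G=GL_+(2,\mathbb{R})$, that is, $\tau_c=g^{\ast}\tau_{gc}$ for all $g\in G$ and all such $c$.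
   Context: Conventions on curves. Smooth means of class $C^3$; curves, parametrizations and reparametrizations are smooth. For $u,v\in\mathbb{R}^2$ write $u\wedge v=\det(u,v)$. A path in the plane is an oriented embedded submanifold $c\subset\mathbb{R}^2$ diffeomorphic to $\mathbb{R}$. A parametrization of $c$ is an embedding $\alpha:I\to\mathbb{R}^2$ of an open interval $I$ with image $c$ such that $\alpha'$ is positive with respect to the orientation of $c$. A curve $\alpha:I\to\mathbb{R}^2$ is $0$-convex if $\alpha\wedge\alpha'$ and $\alpha'\wedge\alpha''$ are both positive functions. A path is $0$-convex if some (equivalently, any) of its parametrizations is $0$-convex. For $g\in GL_+(2,\mathbb{R})$ (linear isomorphisms with positive determinant), $gc$ is the image path $g(c)$ with the orientation carried over by $g$. Centro-affine curvature. A parametrization $\alpha:I\to\mathbb{R}^2$ of a $0$-convex path is called a standard centro-affine parametrization if $\alpha''=-\alpha+\tfrac12\varkappa\,\alpha'$ for some smooth function $\varkappa:I\to\mathbb{R}$; this $\varkappa$ is the centro-affine curvature of $\alpha$, and it induces a well defined function on the path $c$, the centro-affine curvature of $c$. Standing assumption: the paths considered admit a (smooth) standard centro-affine parametrization. Osculating ellipses. All ellipses are centered at $0$ (axes not necessarily parallel to the coordinate axes). The Euclidean curvature of a regular plane curve $\alpha$ is $\kappa_\alpha=(\alpha'\wedge\alpha'')/|\alpha'|^3$. The ellipse centered at $0$ osculating a $0$-convex curve $\alpha$ at $t_0$ is the (unique) ellipse $E$ centered at $0$ having a counterclockwise parametrization $\varepsilon$ with $\varepsilon(0)=\alpha(t_0)$,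 $\varepsilon'(0)$ a multiple of $\alpha'(t_0)$, and $\kappa_\varepsilon(0)=\kappa_\alpha(t_0)$. Lorentz metric on the space of ellipses. Let $\mathcal{E}$ be the set of all ellipses in $\mathbb{R}^2$ centered at $0$, $\mathcal{S}$ the vector space of real symmetric $2\times2$ matrices, and $\mathcal{S}_+\subset\mathcal{S}$ the open subset of positive definite ones. Identify $\mathcal{S}_+$ with $\mathcal{E}$ by the bijection $A\mapsto E_A=\{z\in\mathbb{R}^2\mid\langle A^{-1}z,z\rangle=1\}=A^{1/2}S^1$. The group $G$ acts by $g\cdot A=gAg^T$ on $\mathcal{S}_+$ and by $g\cdot E=g(E)$ on $\mathcal{E}$, and the bijection is equivariant. Endow $\mathcal{S}_+$ with the $G$-invariant Lorentz metric given by $\langle X,X\rangle=\|X\|:=-\det(A^{-1}X)$ for $X\in T_A\mathcal{S}_+\cong\mathcal{S}$ (so $\|\cdot\|$ denotes the quadratic form of the metric, not its square root), and endow $\mathcal{E}$ with the manifold structure and the Lorentz metric transported by this bijection. $\frac{D}{dt}$ denotes the covariant derivative along a curve for the Levi-Civita connection of this metric. A curve is null if its velocity $X$ satisfies $\|X\|=0$ everywhere. *)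

(* Defs.v *)
From HB Require Import structures.
From mathcomp Require Import all_boot all_order all_algebra.
From mathcomp Require Import all_classical all_reals all_analysis.
Set Implicit Arguments.
Unset Strict Implicit.
Unset Printing Implicit Defensive.
Import Order.TTheory GRing.Theory Num.Theory.
Import numFieldNormedType.Exports.
Local Open Scope classical_set_scope.
Local Open Scope ring_scope.
(* Derivatives of functions of a real variable, not of polynomials. *)
Local Notation "f ^` ()" := (derive1 f) : ring_scope.
Local Notation "f ^` ( n )" := (derive1n n f) : ring_scope.

(* Class C^k on an open set U, for maps between finite-dimensional spaces.
   Maps are total, but the definition depends only on their values on U. *)
Fixpoint Ck (R : realType) (k : nat) (V W : normedModType R)
    (U : set V) (f : V -> W) : Prop :=
  match k with
  | 0 => forall x, U x -> {for x, continuous f}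
  | k'.+1 => (forall x, U x -> differentiable f x) /\
             forall v : V, Ck k' U ('D_v f)
  end.

Definition smooth_on (R : realType) (V W : normedModType R)
  (U : set V) (f : V -> W) : Prop := Ck 3 U f.

Definition wedge (R : realType) (u v : 'cV[R]_2) : R := \det (row_mx u v).

(* The norm `|v| of the library on 'cV_2 is the sup norm. *)
Definition euclid_norm (R : realType) (v : 'cV[R]_2) : R :=
  Num.sqrt (\sum_i v i 0 ^+ 2).

Definition open_interval (R : realType) (I : set R) : Prop :=
  open I /\ is_interval I.

(* An immersion that is a homeomorphism onto its image; b is the inverse. *)
Definition embedding (R : realType) (I : set R) (a : R -> 'cV[R]_2) : Prop :=
  [/\ smooth_on I a,
      forall t, I t -> a^`() t != 0
    & exists b : 'cV[R]_2 -> R,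
        (forall t, I t -> b (a t) = t) /\ {within a @` I, continuous b}].

Definition submanifold1 (R : realType) (c : set 'cV[R]_2) : Prop :=
  forall p, c p ->
  exists (U V : set 'cV[R]_2) (f g : 'cV[R]_2 -> 'cV[R]_2),
    [/\ [/\ open U, open V & U p],
        smooth_on U f /\ smooth_on V g,
        f @` U = V,
        forall q, U q -> g (f q) = q
      & f @` (c `&` U) = V `&` [set y | y 1 0 = 0]].

Definition tangent (R : realType) (c : set 'cV[R]_2) (p v : 'cV[R]_2) : Prop :=
  exists (J : set R) (a : R -> 'cV[R]_2),
    [/\ open_interval J /\ J 0, smooth_on J a, a @` J `<=` c,
        a 0 = p & a^`() 0 = v].

(* Smoothness of a function on a submanifold: local smooth extendability. *)
Definition smooth_function_on (R : realType) (c : set 'cV[R]_2)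
    (b : 'cV[R]_2 -> R) : Prop :=
  forall p, c p -> exists (U : set 'cV[R]_2) (B : 'cV[R]_2 -> R),
    [/\ open U, U p, smooth_on U B & forall q, c q -> U q -> B q = b q].

Definition diffeomorphic_to_line (R : realType) (c : set 'cV[R]_2) : Prop :=
  exists (a : R -> 'cV[R]_2) (b : 'cV[R]_2 -> R),
    [/\ smooth_on setT a, range a = c, smooth_function_on c b
      & forall t, b (a t) = t].

(* An orientation is given by its open rays of positive tangent vectors.
   The values of [positive] outside the carrier are irrelevant. *)
Record oriented_set (R : realType) := OrientedSet {
  carrier :> set 'cV[R]_2 ;
  positive : 'cV[R]_2 -> set 'cV[R]_2
}.

(* A choice of a side of 0 in each tangent line, spanned locally by a
   continuous tangent field. *)
Definition is_orientation (R : realType) (c : oriented_set R) : Prop :=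
  forall p, carrier c p -> exists (U : set 'cV[R]_2) (w : 'cV[R]_2 -> 'cV[R]_2),
    [/\ open U, U p, {within (carrier c) `&` U, continuous w}
      & forall q, carrier c q -> U q ->
          [/\ tangent c q (w q), w q != 0
            & positive c q = [set s *: w q | s in [set s : R | 0 < s]]]].

Definition plane_path (R : realType) (c : oriented_set R) : Prop :=
  [/\ submanifold1 c, diffeomorphic_to_line c & is_orientation c].

Definition parametrization (R : realType) (c : oriented_set R)
    (I : set R) (a : R -> 'cV[R]_2) : Prop :=
  [/\ open_interval I, embedding I a, a @` I = c
    & forall t, I t -> positive c (a t) (a^`() t)].

Definition convex0_curve (R : realType) (I : set R) (a : R -> 'cV[R]_2) : Prop :=
  forall t, I t -> 0 < wedge (a t) (a^`() t) /\
                   0 < wedge (a^`() t) (a^`(2) t).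

Definition convex0_path (R : realType) (c : oriented_set R) : Prop :=
  plane_path c /\
  exists (I : set R) (a : R -> 'cV[R]_2),
    parametrization c I a /\ convex0_curve I a.

Definition std_centro_affine (R : realType) (c : oriented_set R)
    (I : set R) (a : R -> 'cV[R]_2) (k : R -> R) : Prop :=
  [/\ parametrization c I a, smooth_on I k
    & forall t, I t -> a^`(2) t = - a t + (2^-1 * k t) *: a^`() t].

Definition centro_affine_curvature (R : realType) (c : oriented_set R)
    (p : 'cV[R]_2) : R :=
  get [set r | exists (I : set R) (a : R -> 'cV[R]_2) (k : R -> R) (t : R),
         [/\ std_centro_affine c I a k, I t, a t = p & k t = r]].

(* The 0-convex paths with nowhere vanishing centro-affine curvature. *)
Definition curved_path (R : realType) (c : oriented_set R) : Prop :=
  [/\ convex0_path c,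
      exists (I : set R) (a : R -> 'cV[R]_2) (k : R -> R),
        std_centro_affine c I a k
    & forall p, carrier c p -> centro_affine_curvature c p != 0].

(* For \det g > 0. *)
Definition path_image (R : realType) (g : 'M[R]_2) (c : oriented_set R) :
    oriented_set R :=
  OrientedSet (mulmx g @` c)
    (fun q => mulmx g @` positive c (invmx g *m q)).

Definition sym_mx (R : realType) : set 'M[R]_2 := [set X | X^T = X].

Definition posdef_mx (R : realType) : set 'M[R]_2 :=
  [set A | A^T = A /\ forall z : 'cV[R]_2, z != 0 -> 0 < (z^T *m A *m z) 0 0].

Definition ellipse_of (R : realType) (A : 'M[R]_2) : set 'cV[R]_2 :=
  [set z | (z^T *m invmx A *m z) 0 0 = 1].

Definition is_ellipse (R : realType) (E : set 'cV[R]_2) : Prop :=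
  exists2 A, posdef_mx A & E = ellipse_of A.

(* The inverse of the bijection [ellipse_of] from posdef_mx to ellipses: the
   global chart through which ellipses get manifold structure and metric. *)
Definition ellipse_mx (R : realType) (E : set 'cV[R]_2) : 'M[R]_2 :=
  get [set A | posdef_mx A /\ ellipse_of A = E].

Definition ccw_parametrization (R : realType) (E : set 'cV[R]_2)
    (e : R -> 'cV[R]_2) : Prop :=
  [/\ smooth_on setT e, range e = E & forall t, 0 < wedge (e t) (e^`() t)].

Definition euclid_curvature (R : realType) (a : R -> 'cV[R]_2) (t : R) : R :=
  wedge (a^`() t) (a^`(2) t) / euclid_norm (a^`() t) ^+ 3.

Definition osculates (R : realType) (a : R -> 'cV[R]_2) (t0 : R)
    (E : set 'cV[R]_2) : Prop :=
  is_ellipse E /\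
  exists e : R -> 'cV[R]_2,
    [/\ ccw_parametrization E e, e 0 = a t0,
        exists s : R, e^`() 0 = s *: a^`() t0
      & euclid_curvature e 0 = euclid_curvature a t0].

Definition osculating_ellipse (R : realType) (a : R -> 'cV[R]_2) (t0 : R) :
    set 'cV[R]_2 := get (osculates a t0).

Definition sqnorm (R : realType) (A X : 'M[R]_2) : R := - \det (invmx A *m X).

Definition metric (R : realType) (A X Y : 'M[R]_2) : R :=
  2^-1 * (sqnorm A (X + Y) - sqnorm A X - sqnorm A Y).

(* Affine connections on the open subset posdef_mx of the vector space sym_mx
   are written nabla_Z X = 'D_Z X + G A Z X, with G the Christoffel tensor of
   the linear chart. The three conditions are: bilinearity, vanishing torsion,
   and compatibility with the metric (on constant fields X and Y). *)
Definition is_levi_civita (R : realType)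
    (G : 'M[R]_2 -> 'M[R]_2 -> 'M[R]_2 -> 'M[R]_2) : Prop :=
  forall A, posdef_mx A ->
  [/\ forall X Y, sym_mx X -> sym_mx Y -> sym_mx (G A X Y),
      forall (r : R) X Y Z, sym_mx X -> sym_mx Y -> sym_mx Z ->
        G A (r *: X + Y) Z = r *: G A X Z + G A Y Z /\
        G A Z (r *: X + Y) = r *: G A Z X + G A Z Y,
      forall X Y, sym_mx X -> sym_mx Y -> G A X Y = G A Y X
    & forall X Y Z, sym_mx X -> sym_mx Y -> sym_mx Z ->
        'D_Z (fun B => metric B X Y : R) A =
          metric A (G A Z X) Y + metric A X (G A Z Y)].

Definition levi_civita (R : realType) :
    'M[R]_2 -> 'M[R]_2 -> 'M[R]_2 -> 'M[R]_2 := get (@is_levi_civita R).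

Definition cov_derivative (R : realType) (A X : R -> 'M[R]_2) (t : R) :
    'M[R]_2 := X^`() t + levi_civita (A t) (A^`() t) (X t).

(* The curve of osculating ellipses, read in the chart [ellipse_mx]. *)
Definition osc_curve (R : realType) (a : R -> 'cV[R]_2) (t : R) : 'M[R]_2 :=
  ellipse_mx (osculating_ellipse a t).

Definition velocity_sqnorm (R : realType) (A : R -> 'M[R]_2) (t : R) : R :=
  sqnorm (A t) (A^`() t).

Definition acceleration_sqnorm (R : realType) (A : R -> 'M[R]_2) (t : R) : R :=
  sqnorm (A t) (cov_derivative A (A^`()) t).

(* Continuous 1-forms on c, as functions of base point and tangent vector;
   only the values on tangent vectors of c are meaningful. *)
Definition is_one_form (R : realType) (c : set 'cV[R]_2)
    (tau : 'cV[R]_2 -> 'cV[R]_2 -> R) : Prop :=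
  (forall p, c p -> forall (r : R) v w, tangent c p v -> tangent c p w ->
     tau p (r *: v + w) = r * tau p v + tau p w) /\
  {within [set x : 'cV[R]_2 * 'cV[R]_2 | tangent c x.1 x.2],
     continuous (fun x => tau x.1 x.2 : R)}.

Definition eq_one_form (R : realType) (c : set 'cV[R]_2)
    (tau tau' : 'cV[R]_2 -> 'cV[R]_2 -> R) : Prop :=
  forall p v, c p -> tangent c p v -> tau p v = tau' p v.

Definition pullback_linear (R : realType) (g : 'M[R]_2)
    (tau : 'cV[R]_2 -> 'cV[R]_2 -> R) : 'cV[R]_2 -> 'cV[R]_2 -> R :=
  fun p v => tau (g *m p) (g *m v).

(* The pullback of tau by the parametrization a of c is
   (sqnorm of the acceleration of the osculating ellipses)^(1/4) dt. *)
Definition arc_element (R : realType) (I : set R) (a : R -> 'cV[R]_2)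
    (tau : 'cV[R]_2 -> 'cV[R]_2 -> R) : Prop :=
  forall t, I t ->
    tau (a t) (a^`() t) = acceleration_sqnorm (osc_curve a) t `^ 4^-1.

(* Main.v *)
Require Import Defs.
From HB Require Import structures.
From mathcomp Require Import all_boot all_order all_algebra.
From mathcomp Require Import all_classical all_reals all_analysis.
From mathcomp Require Import ring lra.
Set Implicit Arguments.
Unset Strict Implicit.
Unset Printing Implicit Defensive.
Import Order.TTheory GRing.Theory Num.Theory.
Import numFieldNormedType.Exports.
Local Open Scope classical_set_scope.
Local Open Scope ring_scope.
Local Notation "f ^` ()" := (derive1 f) : ring_scope.
Local Notation "f ^` ( n )" := (derive1n n f) : ring_scope.

(** Write [u /\ v] for [wedge u v]. Any parametrization of a path as in the
    theorem has the form [a o phi], where [a] is a standard centro-affine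
    parametrization, with curvature [k], and [phi] is an orientation preserving
    change of parameter. Since [a] satisfies [a'' = - a + k a' / 2] with [k] of
    class [C^3], its derivative [a'] is again of class [C^3], and so is [phi].

    The ellipse centered at 0 osculating a curve [f] has the matrix
    [f f^T + (f /\ f') / (f' /\ f'') f' f'^T]: the quadratic form of the inverse
    matrix equals 1 along the ellipse, and its first two derivatives, together
    with the curvature condition, determine the form in the basis [f], [f']
    ([osc_curveE]). For [a] this is [A = a a^T + a' a'^T], because [a' /\ a''] and
    [a /\ a'] agree; and the osculating ellipses of [a o phi] are [A o phi]
    ([osc_curve_factor]). Hence the curve of osculating ellipses is of class
    [C^3], although its definition involves second derivatives.

    The defining equation of [a] gives [A' = k a' a'^T], a matrix of rank 1, so
    the curve is null. The metric is [- det X / det A], a conformal multiple of a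
    flat metric, with the explicit Levi-Civita connection [christoffel]; along a
    null curve its Christoffel term is a multiple of the velocity, which is
    orthogonal to the second derivative. Therefore the norm of the acceleration
    is [- det (A o phi)'' / det (A o phi) = phi'^4 k^2] ([osc_curve_along]), which
    is positive, and its fourth root is [phi' |k|^(1/2)].

    So the 1-form sought is [|k|^(1/2)] times the differential of the standard
    parameter, [ellipse_arc_form]. It is well defined because two standard
    parametrizations of a path have the same velocity and the same curvature at
    each point ([std_centro_affine_uniq]), and it is invariant because a linear
    map [g] of positive determinant carries standard parametrizations to standard
    parametrizations with the same curvature ([std_centro_affine_mulmx]). *)

(** * Maps of class C^k *)

Lemma open_near (R : realType) (V : normedModType R) (U : set V) (x : V) :
  open U -> U x -> \forall y \near x, U y.
Proof. by move=> oU Ux; apply: open_nbhs_nbhs. Qed.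

Lemma near_eq_differentiable (R : realType) (V W : normedModType R)
    (f g : V -> W) (x : V) :
  (\near x, f x = g x) -> differentiable f x -> differentiable g x.
Proof.
move=> fg /diff_locallyP[fc fE]; have fgx := nbhs_singleton fg.
(* [f] and [g] have the same first-order expansion at [x]. *)
suff H : g \o shift x = cst (g x) + 'd f x +o_ 0 id.
  have gE := diff_unique fc H.
  by apply/diff_locallyP; rewrite gE.
apply/eqaddoP => e e0; move/eqaddoP : fE => /(_ e e0).
have fg0 : \forall h \near (0 : V), f (h + x) = g (h + x).
  have : (fun h => h + x) @ (0 : V) --> x.
    by rewrite -[X in _ --> X]add0r; apply: cvgD; [exact: cvg_id|exact: cvg_cst].
  by move=> /(_ _ fg).
by apply: filterS2 fg0 => h; rewrite !fctE/= fgx => ->.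
Qed.

Lemma Ck_eq (R : realType) (V W : normedModType R) k (U : set V) (f g : V -> W) :
  open U -> (forall x, U x -> f x = g x) -> Ck k U f -> Ck k U g.
Proof.
move=> oU; elim: k f g => [|k IH] f g fg /=.
  move=> fc x Ux; suff : g @ x --> g x by [].
  rewrite -(fg _ Ux).
  apply: cvg_trans (fc x Ux); apply: near_eq_cvg.
  by apply: filterS (open_near oU Ux) => y Uy; rewrite fg.
have nfg x : U x -> \near x, f x = g x.
  by move=> Ux; apply: filterS (open_near oU Ux) => y Uy; rewrite fg.
move=> [df Df]; split.
  by move=> x Ux; apply: near_eq_differentiable (df x Ux); exact: nfg.
move=> v; apply: IH (Df v) => x Ux; apply: near_eq_derive; exact: nfg.
Qed.

Lemma CkW (R : realType) (V W : normedModType R) k (U : set V) (f : V -> W) :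
  Ck k.+1 U f -> Ck k U f.
Proof.
elim: k f => [|k IH] f [df Df].
  by move=> x Ux; apply: differentiable_continuous; exact: df.
by split=> // v; exact: IH.
Qed.

Lemma Ck_le (R : realType) (V W : normedModType R) j k (U : set V) (f : V -> W) :
  (j <= k)%N -> Ck k U f -> Ck j U f.
Proof.
move=> jk; rewrite -(subnK jk); elim: (k - j)%N => // n IH.
by rewrite addSn => /CkW.
Qed.

Lemma Ck_cst (R : realType) (V W : normedModType R) k (U : set V) (w : W) :
  Ck k U (cst w : V -> W).
Proof.
elim: k w => [|k IH] w /=; first by move=> x _; exact: cvg_cst.
split=> // v; rewrite (_ : 'D_v (cst w) = cst 0) //.
by apply/funext => x; rewrite derive_cst.
Qed.

Lemma CkD (R : realType) (V W : normedModType R) k (U : set V) (f g : V -> W) :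
  open U -> Ck k U f -> Ck k U g -> Ck k U (fun x => f x + g x).
Proof.
move=> oU; elim: k f g => [|k IH] f g /=.
  by move=> fc gc x Ux; apply: cvgD; [exact: fc|exact: gc].
move=> [df Df] [dg Dg]; split=> [x Ux|v].
  by apply: differentiableD; [exact: df|exact: dg].
apply: (Ck_eq oU _ (IH _ _ (Df v) (Dg v))) => x Ux.
by rewrite -deriveD//; apply: diff_derivable; [exact: df|exact: dg].
Qed.

(** Postcomposition by a continuous linear map. *)
Lemma Ck_linear_comp (R : realType) (V W W' : normedModType R) k (U : set V)
    (L : {linear W -> W'}) (f : V -> W) :
  open U -> continuous L -> Ck k U f -> Ck k U (fun x => L (f x)).
Proof.
move=> oU cL; elim: k f => [|k IH] f /=.
  by move=> fc x Ux; apply: continuous_comp; [exact: fc|exact: cL].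
move=> [df Df].
have dL x : differentiable L x by exact: linear_differentiable.
split=> [x Ux|v]; first by apply: differentiable_comp; [exact: df|exact: dL].
apply: (Ck_eq oU _ (IH _ (Df v))) => x Ux.
have dfx := df _ Ux; have dLfx := differentiable_comp dfx (dL _).
rewrite !deriveE //.
by rewrite (diff_comp (df x Ux) (dL _)) /= diff_lin.
Qed.

(** Precomposition by a continuous linear map. *)
Lemma Ck_comp_linear (R : realType) (V V' W : normedModType R) k (U : set V)
    (L : {linear V' -> V}) (f : V -> W) :
  open U -> continuous L -> Ck k U f -> Ck k (L @^-1` U) (fun x => f (L x)).
Proof.
move=> oU cL; have oLU : open (L @^-1` U).
  by apply: open_comp => // x _; exact: cL.
elim: k f => [|k IH] f /=.
  by move=> fc x Ux; apply: continuous_comp; [exact: cL|exact: fc].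
move=> [df Df].
have dL x : differentiable L x by exact: linear_differentiable.
split=> [x Ux|v].
  by apply: differentiable_comp; [exact: dL|exact: df].
apply: (Ck_eq oLU _ (IH _ (Df (L v)))) => x Ux.
have dfx := df _ Ux; have dfLx := differentiable_comp (dL x) dfx.
rewrite !deriveE //.
by rewrite (diff_comp (dL x) (df _ Ux)) /= diff_lin.
Qed.

(** On functions of a real variable, all directional derivatives are multiples
    of [derive1], so the class [C^k] can be read off iterated derivatives. *)
Lemma CkS_derive1 (R : realType) (W : normedModType R) k (U : set R)
    (f : R -> W) : open U ->
  Ck k.+1 U f <-> (forall x, U x -> derivable f x 1) /\ Ck k U f^`().
Proof.
move=> oU; have E : f^`() = 'D_1 f by apply/funext => x; rewrite derive1E.
split=> /= -[df Df].
  split=> [x Ux|]; first exact/diff_derivable/df.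
  by rewrite E.
have df' x : U x -> differentiable f x by move=> Ux; apply/derivable1_diffP/df.
split=> // v.
have cv : continuous ( *:%R v : W -> W) by exact: scaler_continuous.
apply: (Ck_eq oU _ (Ck_linear_comp oU cv Df)) => x Ux /=.
rewrite derive1E !deriveE; [|exact: df'|exact: df'].
by rewrite -linearZ /= /GRing.scale /= mulr1.
Qed.

Lemma Ck_derive1 (R : realType) (W : normedModType R) k (U : set R)
    (f : R -> W) : open U -> Ck k.+1 U f -> Ck k U f^`().
Proof. by move=> oU /(CkS_derive1 _ _ oU)[]. Qed.

Lemma Ck_derivable (R : realType) (W : normedModType R) k (U : set R)
    (f : R -> W) x : open U -> Ck k.+1 U f -> U x -> derivable f x 1.
Proof. by move=> oU /(CkS_derive1 _ _ oU)[+ _]; exact. Qed.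

Lemma CkM (R : realType) k (U : set R) (f g : R -> R) :
  open U -> Ck k U f -> Ck k U g -> Ck k U (fun x => f x * g x).
Proof.
move=> oU; elim: k f g => [|k IH] f g.
  by move=> fc gc x Ux; apply: cvgM; [exact: fc|exact: gc].
move=> fk gk.
have [df Df] := (CkS_derive1 k f oU).1 fk.
have [dg Dg] := (CkS_derive1 k g oU).1 gk.
apply/(CkS_derive1 _ _ oU); split=> [x Ux|].
  by apply: derivableM; [exact: df|exact: dg].
have := CkD oU (IH _ _ (CkW fk) Dg) (IH _ _ (CkW gk) Df).
apply: Ck_eq => // x Ux; rewrite !derive1E -deriveM //; [exact: df|exact: dg].
Qed.

Lemma CkZ (R : realType) (W : normedModType R) k (U : set R) (f : R -> W) r :
  open U -> Ck k U f -> Ck k U (fun x => r *: f x).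
Proof. by move=> oU; apply: Ck_linear_comp => //; exact: scaler_continuous. Qed.

Lemma CkV (R : realType) k (U : set R) (f : R -> R) :
  open U -> (forall x, U x -> f x != 0) -> Ck k U f ->
  Ck k U (fun x => (f x)^-1).
Proof.
move=> oU f0; elim: k => [|k IH].
  by move=> fc x Ux; apply: cvgV; [exact: f0|exact: fc].
move=> fk.
have [df Df] := (CkS_derive1 k f oU).1 fk.
apply/(CkS_derive1 _ _ oU); split=> [x Ux|].
  by apply: derivableV; [exact: f0|exact: df].
have ik := IH (CkW fk).
have := CkM oU (CkZ (-1) oU (CkM oU ik ik)) Df.
apply: Ck_eq => // x Ux; rewrite !derive1E deriveV; [|exact: f0|exact: df].
by rewrite /GRing.scale /= mulN1r expr2 invfM.
Qed.

(** Composition of functions of a real variable. *)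
Lemma Ck_comp (R : realType) k (U V : set R) (f g : R -> R) :
  open U -> open V -> (forall x, U x -> V (g x)) ->
  Ck k V f -> Ck k U g -> Ck k U (fun x => f (g x)).
Proof.
move=> oU oV UV; elim: k f => [|k IH] f.
  by move=> fc gc x Ux; apply: continuous_comp; [exact: gc|exact/fc/UV].
move=> fk gk.
have [df Df] := (CkS_derive1 k f oV).1 fk.
have [dg Dg] := (CkS_derive1 k g oU).1 gk.
have dfg x : U x -> is_derive x 1 (f \o g) (f^`() (g x) * g^`() x).
  by move=> Ux; rewrite !derive1E; apply: is_derive1_comp;
    apply: derivableP; [exact/df/UV|exact: dg].
apply/(CkS_derive1 _ _ oU); split=> [x Ux|].
  by apply: ex_derive; exact: dfg.
have := CkM oU (IH _ Df (CkW gk)) Dg.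
by apply: Ck_eq => // x Ux; rewrite [RHS]derive1E; apply/esym/derive_val/dfg.
Qed.

Lemma Ck_mxP (R : realType) (V : normedModType R) k m n (U : set V)
    (f : V -> 'M[R]_(m, n)) : open U ->
  Ck k U f <-> forall i j, Ck k U (fun t => f t i j : R).
Proof.
move=> oU; split=> [fk i j|fk].
  pose L : 'M[R]_(m, n) -> R := fun N => N i j.
  have lL : linear L by move=> a u v; rewrite /L !mxE.
  pose LL := GRing.isLinear.Build _ _ _ _ L lL.
  pose L' : {linear 'M[R]_(m, n) -> R} := HB.pack L LL.
  by apply: (@Ck_linear_comp _ _ _ _ _ _ L') => //; exact: coord_continuous.
have E : f = fun t => \sum_i \sum_j f t i j *: delta_mx i j.
  by apply/funext => t; rewrite -matrix_sum_delta.
rewrite E.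
have sumCk (I : finType) (F : I -> V -> 'M[R]_(m, n)) :
    (forall i, Ck k U (F i)) -> Ck k U (fun t => \sum_i F i t).
  move=> FC; elim: (index_enum I) => [|i s IHs].
    rewrite (_ : (fun _ => _) = cst 0); first exact: Ck_cst.
    by apply/funext => t; rewrite big_nil.
  rewrite (_ : (fun _ => _) = fun t => F i t + \sum_(i <- s) F i t).
    exact: CkD.
  by apply/funext => t; rewrite big_cons.
apply: (sumCk) => i; apply: (sumCk) => j.
pose D : 'M[R]_(m, n) := delta_mx i j.
pose L : R -> 'M[R]_(m, n) := fun r => r *: D.
have lL : linear L by move=> a u v; rewrite /L scalerDl scalerA.
pose LL := GRing.isLinear.Build _ _ _ _ L lL.
pose L' : {linear R -> 'M[R]_(m, n)} := HB.pack L LL.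
apply: (@Ck_linear_comp _ _ _ _ _ _ L') => //.
exact: scalel_continuous.
Qed.

(** * Curves in the plane and changes of parameter *)

Lemma ord2P (i : 'I_2) : i = 0 \/ i = 1.
Proof.
by case: i => [[|[|m]] im] //; [left|right]; apply: val_inj.
Qed.

Lemma det2E (R : comNzRingType) (A : 'M[R]_2) :
  \det A = A 0 0 * A 1 1 - A 0 1 * A 1 0.
Proof.
rewrite (expand_det_row _ 0) !big_ord_recl big_ord0 addr0 /cofactor !det_mx11.
rewrite !mxE /= !(expr0, expr1, mul1r) /bump /= mulN1r mulrN.
have -> : lift (0 : 'I_2) 0 = 1 by apply: val_inj.
by have -> : lift (1 : 'I_2) 0 = 0 by apply: val_inj.
Qed.

Lemma sum2E (V : zmodType) (F : 'I_2 -> V) : \sum_i F i = F 0 + F 1.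
Proof.
rewrite !big_ord_recl big_ord0 addr0.
by have -> : lift (0 : 'I_2) 0 = 1 by apply: val_inj.
Qed.

Lemma wedgeE (R : realType) (u v : 'cV[R]_2) :
  wedge u v = u 0 0 * v 1 0 - v 0 0 * u 1 0.
Proof.
have E0 i : row_mx u v i (0 : 'I_2) = u i 0.
  by rewrite -(row_mxEl u v i 0); congr (row_mx u v i _); exact: val_inj.
have E1 i : row_mx u v i (1 : 'I_2) = v i 0.
  by rewrite -(row_mxEr u v i 0); congr (row_mx u v i _); exact: val_inj.
by rewrite /wedge det2E !E0 !E1.
Qed.

Lemma cV2P (R : realType) (u v : 'cV[R]_2) :
  u 0 0 = v 0 0 -> u 1 0 = v 1 0 -> u = v.
Proof.
by move=> e0 e1; apply/matrixP => i j; rewrite ord1; case: (ord2P i) => ->.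
Qed.

Lemma M2P (R : realType) (A B : 'M[R]_2) :
  A 0 0 = B 0 0 -> A 0 1 = B 0 1 -> A 1 0 = B 1 0 -> A 1 1 = B 1 1 -> A = B.
Proof.
move=> *; apply/matrixP => i j.
by case: (ord2P i) => ->; case: (ord2P j) => ->.
Qed.

Lemma wedgeZl (R : realType) s (u v : 'cV[R]_2) :
  wedge (s *: u) v = s * wedge u v.
Proof. by rewrite !wedgeE !mxE; ring. Qed.

Lemma wedgeZr (R : realType) s (u v : 'cV[R]_2) :
  wedge u (s *: v) = s * wedge u v.
Proof. by rewrite !wedgeE !mxE; ring. Qed.

Lemma wedgeDr (R : realType) (u v w : 'cV[R]_2) :
  wedge u (v + w) = wedge u v + wedge u w.
Proof. by rewrite !wedgeE !mxE; ring. Qed.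

Lemma wedgeC (R : realType) (u v : 'cV[R]_2) : wedge v u = - wedge u v.
Proof. by rewrite !wedgeE; ring. Qed.

Lemma wedge_neq0r (R : realType) (u v : 'cV[R]_2) : 0 < wedge u v -> v != 0.
Proof.
by apply: contraTneq => ->; rewrite wedgeE !mxE !(mulr0, mul0r) subrr ltxx.
Qed.

Lemma wedge_mulmx (R : realType) (g : 'M[R]_2) (u v : 'cV[R]_2) :
  wedge (g *m u) (g *m v) = \det g * wedge u v.
Proof. by rewrite !wedgeE det2E !mxE !sum2E; ring. Qed.

Lemma derive1_mxE (R : realType) m n (f : R -> 'M[R]_(m, n)) t i j :
  derivable f t 1 -> f^`() t i j = (fun t => f t i j)^`() t.
Proof. by move=> df; rewrite !derive1E derive_mx // mxE. Qed.

Lemma Ck_wedge (R : realType) k (U : set R) (f g : R -> 'cV[R]_2) :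
  open U -> Ck k U f -> Ck k U g -> Ck k U (fun t => wedge (f t) (g t)).
Proof.
move=> oU /(Ck_mxP _ _ oU) fk /(Ck_mxP _ _ oU) gk.
have := CkD oU (CkM oU (fk 0 0) (gk 1 0)) (CkZ (-1) oU (CkM oU (gk 0 0) (fk 1 0))).
by apply: Ck_eq => // t _; rewrite wedgeE /GRing.scale /= mulN1r.
Qed.

(** Chain rule for a curve precomposed with a change of parameter. *)
Lemma is_derive_curve_comp (R : realType) m n (f : R -> 'M[R]_(m, n)) (phi : R -> R) t :
  derivable phi t 1 -> derivable f (phi t) 1 ->
  derivable (f \o phi) t 1 /\
  (f \o phi)^`() t = phi^`() t *: f^`() (phi t).
Proof.
move=> dphi df.
have dij i j : is_derive t 1 (fun t => f (phi t) i j)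
    (f^`() (phi t) i j * phi^`() t).
  rewrite (derive1_mxE _ _ df) !derive1E.
  apply: (@is_derive1_comp _ (fun t => f t i j) phi); apply: derivableP.
    exact: ((derivable_mxP _ _ _).1 df).
  exact: dphi.
have dfphi : derivable (f \o phi) t 1.
  by apply/derivable_mxP => i j; apply: ex_derive; exact: dij.
split=> //; apply/matrixP => i j.
have [_ E] := dij i j.
by rewrite (derive1_mxE _ _ dfphi) [LHS]derive1E [LHS]E mxE mulrC.
Qed.

(** A continuous change of parameter [phi] between two differentiable functions
    is differentiable wherever the outer derivative does not vanish. *)
Lemma derivable_factor (R : realType) (f g phi : R -> R) t :
  derivable f (phi t) 1 -> f^`() (phi t) != 0 -> derivable g t 1 ->
  {for t, continuous phi} -> (\near t, g t = f (phi t)) -> derivable phi t 1.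
Proof.
move=> df f'0 dg cphi gE.
have Df : is_derive (phi t) 1 f (f^`() (phi t)).
  by rewrite derive1E; apply: derivableP; exact: df.
have Dg : is_derive t 1 g (g^`() t).
  by rewrite derive1E; apply: derivableP; exact: dg.
(* Caratheodory slopes: the slope [F] of [f] is continuous and nonzero at
   [phi t], hence nonzero along [phi] near [t]. *)
have [F [FE cF F0]] := (is_derive1_caratheodory _ _ _).1 Df.
have [G [GE cG G0]] := (is_derive1_caratheodory _ _ _).1 Dg.
have cFphi : {for t, continuous (F \o phi)} by exact: continuous_comp.
have Fn0 : \forall x \near t, F (phi x) != 0.
  have : (F \o phi) @ t --> F (phi t) by exact: cFphi.
  by rewrite F0 => /cvgr_neq0; exact.
have gt : g t = f (phi t) := nbhs_singleton gE.
have E : \forall x \near t, phi x - phi t = G x / F (phi x) * (x - t).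
  near=> x.
  have gx : g x = f (phi x) by near: x.
  have Fx : F (phi x) != 0 by near: x.
  apply: (mulfI Fx); rewrite -FE -gx -gt GE.
  by field.
have near_phi : \forall x \near t, phi t + G x / F (phi x) * (x - t) = phi x.
  by apply: filterS E => x <-; rewrite addrC subrK.
apply: (near_eq_derivable near_phi).
have : is_derive t 1 (fun x => phi t + G x / F (phi x) * (x - t)) (G t / F (phi t)).
  apply/is_derive1_caratheodory; exists (fun x => G x / F (phi x)); split=> //.
  - by move=> z; ring.
  - apply: cvgM; first exact: cG.
    by apply: cvgV; [rewrite F0|exact: cFphi].
by case.
Unshelve. all: by end_near. Qed.

Lemma derivable_factor_curve (R : realType) n (f g : R -> 'cV[R]_n)
    (phi : R -> R) t :
  derivable f (phi t) 1 -> f^`() (phi t) != 0 -> derivable g t 1 ->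
  {for t, continuous phi} -> (\near t, g t = f (phi t)) ->
  derivable phi t 1 /\ g^`() t = phi^`() t *: f^`() (phi t).
Proof.
move=> df f'0 dg cphi gE.
have dphi : derivable phi t 1.
  have [i fi0] : exists i, f^`() (phi t) i 0 != 0.
    apply: contrapT => H; move/eqP : f'0; apply; apply/matrixP => i j.
    rewrite ord1 mxE; apply: contrapT => fi; apply: H; exists i; exact/eqP.
  apply: (@derivable_factor _ (fun t => f t i 0) (fun t => g t i 0)) => //.
  - by move/derivable_mxP : df.
  - by rewrite -derive1_mxE.
  - by move/derivable_mxP : dg.
  - by apply: filterS gE => x ->.
split=> //; have [_ <-] := is_derive_curve_comp dphi df.
by rewrite !derive1E; exact: near_eq_derive.
Qed.

Lemma embedding_inj (R : realType) (I : set R) (a : R -> 'cV[R]_2) u v :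
  embedding I a -> I u -> I v -> a u = a v -> u = v.
Proof. by move=> [_ _ [b [ba _]]] Iu Iv E; rewrite -(ba _ Iu) -(ba _ Iv) E. Qed.

(** A curve with values in an embedded curve factors through the embedding. *)
Lemma embedding_factor (R : realType) k (I J : set R) (a f : R -> 'cV[R]_2) :
  open I -> embedding I a -> open J -> Ck k.+1 J f -> f @` J `<=` a @` I ->
  exists phi : R -> R, forall t, J t ->
    [/\ I (phi t), f t = a (phi t), {for t, continuous phi}, derivable phi t 1
      & f^`() t = phi^`() t *: a^`() (phi t)].
Proof.
move=> oI [aS a'0 [b [ba cb]]] oJ fS fJ; 
(* The change of parameter is [f] followed by the inverse [b] of [a]. *)
exists (b \o f) => t Jt.
have fa s : J s -> I (b (f s)) /\ f s = a (b (f s)).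
  move=> Js; have [u Iu au] : (a @` I) (f s) by apply: fJ; exists s.
  by rewrite -au ba.
have cphi : {for t, continuous (b \o f)}.
  have cft : f @ t --> f t.
    apply: differentiable_continuous; apply/derivable1_diffP.
    exact: (Ck_derivable oJ fS Jt).
  have aIf : (a @` I) (f t) by apply: fJ; exists t.
  have cbt := (subspace_continuousP _ _).1 cb _ aIf.
  suff : (b \o f) @ t --> (b \o f) t by [].
  apply: cvg_comp cbt => P; rewrite !nbhs_simpl /= => wP.
  have := cft _ wP; rewrite nbhs_simpl /=.
  apply: filterS2 (open_near oJ Jt) => s Js; apply.
  by apply: fJ; exists s.
have [Ip fE] := fa t Jt.
have [|dphi f'E] := @derivable_factor_curve _ _ a f (b \o f) t
   (@Ck_derivable _ _ 2 _ _ _ oI aS Ip) (a'0 _ Ip) (Ck_derivable oJ fS Jt) cphi.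
  by apply: filterS (open_near oJ Jt) => s Js; have [] := fa _ Js.
by split.
Qed.

(** The tangent line of an embedded curve is spanned by its velocity. *)
Lemma tangent_embedding (R : realType) (I : set R) (a : R -> 'cV[R]_2) u v :
  open I -> embedding I a -> I u -> tangent (a @` I) (a u) v ->
  exists s, v = s *: a^`() u.
Proof.
move=> oI ea Iu [J [f [[[oJ _] J0] fS fJ f0 f'0]]].
have [phi /(_ _ J0)[Ip fE _ _ f'E]] := @embedding_factor _ 2 _ _ _ _ oI ea oJ fS fJ.
exists (phi^`() 0); rewrite -f'0 f'E; congr (_ *: a^`() _).
by apply: (embedding_inj ea) => //; rewrite -fE.
Qed.

(** * Ellipses centered at the origin *)

Lemma outerE (R : realType) (u v : 'cV[R]_2) i j :
  (u *m v^T) i j = u i 0 * v j 0.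
Proof. by rewrite !mxE big_ord_recl big_ord0 addr0 mxE. Qed.

(** The quadratic form of the inverse of a matrix, by Cramer's rule. *)
Lemma inv_form2E (R : realType) (A : 'M[R]_2) (z : 'cV[R]_2) : \det A != 0 ->
  (z^T *m invmx A *m z) 0 0 =
  (A 1 1 * z 0 0 ^+ 2 - (A 0 1 + A 1 0) * (z 0 0 * z 1 0)
     + A 0 0 * z 1 0 ^+ 2) / \det A.
Proof.
move=> dA.
(* [B] is the adjugate of [A], divided by the determinant. *)
pose B : 'M[R]_2 := \matrix_(i, j)
  ((if i == 0 then if j == 0 then A 1 1 else - A 0 1
    else if j == 0 then - A 1 0 else A 0 0) / \det A).
have AB : A *m B = 1%:M.
  have dE := det2E A.
  apply: M2P; rewrite !mxE sum2E !mxE /=; apply: (mulIf dA); 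
    rewrite mulrDl !mulrA !divfK // ?mul1r ?mul0r ?dE; ring.
have uA : A \in unitmx by rewrite unitmxE unitfE.
have -> : invmx A = B by rewrite -[RHS]mul1mx -(mulVmx uA) -mulmxA AB mulmx1.
by rewrite !mxE !sum2E !mxE !sum2E !mxE /=; ring.
Qed.

Lemma form2E (R : realType) (A : 'M[R]_2) (z : 'cV[R]_2) :
  (z^T *m A *m z) 0 0 = A 0 0 * z 0 0 ^+ 2 + (A 0 1 + A 1 0) * (z 0 0 * z 1 0)
     + A 1 1 * z 1 0 ^+ 2.
Proof. by rewrite !mxE !sum2E !mxE !sum2E !mxE /=; ring. Qed.

(** The column vector with entries [x] and [y]. *)
Definition vec2 (R : realType) (x y : R) : 'cV[R]_2 :=
  \col_i (if i == 0 then x else y).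

(** Sylvester's criterion. *)
Lemma posdef2P (R : realType) (A : 'M[R]_2) :
  posdef_mx A <-> [/\ A 1 0 = A 0 1, 0 < A 0 0 & 0 < \det A].
Proof.
split=> [[sA pA]|[sA A0 dA]].
  have s : A 1 0 = A 0 1 by rewrite -{1}sA mxE.
  have A0 : 0 < A 0 0.
    have := pA (vec2 1 0); rewrite form2E !mxE /= => H.
    have : 0 < A 0 0 * 1 ^+ 2 + (A 0 1 + A 1 0) * (1 * 0) + A 1 1 * 0 ^+ 2.
      apply: H; apply/eqP => /matrixP /(_ 0 0); rewrite !mxE /=.
      by move/eqP; rewrite oner_eq0.
    by rewrite [X in 0 < X](_ : _ = A 0 0) //; ring.
  split=> //.
  (* The form takes the value [A 0 0 * \det A] on the following vector. *)
  have := pA (vec2 (- A 0 1) (A 0 0)); rewrite form2E !mxE /= => H.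
  have : 0 < A 0 0 * (- A 0 1) ^+ 2 + (A 0 1 + A 1 0) * (- A 0 1 * A 0 0)
    + A 1 1 * A 0 0 ^+ 2.
    apply: H; apply/eqP => /matrixP /(_ 1 0); rewrite !mxE /=.
    by move/eqP; rewrite (gt_eqF A0).
  rewrite (_ : _ + _ = A 0 0 * \det A); last by rewrite det2E s; ring.
  by rewrite pmulr_rgt0.
split; first by apply: M2P; rewrite ?mxE.
move=> z z0; rewrite form2E.
rewrite -(pmulr_rgt0 _ A0).
rewrite [X in 0 < X](_ : _ = (A 0 0 * z 0 0 + A 0 1 * z 1 0) ^+ 2
   + \det A * z 1 0 ^+ 2); last first.
  by rewrite det2E sA; ring.
have [z1|z1] := eqVneq (z 1 0) 0.
  have z00 : z 0 0 != 0.
    by apply: contra z0 => /eqP z00; apply/eqP/cV2P; rewrite ?z00 ?z1 mxE.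
  rewrite z1 mulr0 addr0 expr0n mulr0 addr0 exprn_even_gt0 //=.
  by rewrite mulf_eq0 negb_or z00 gt_eqF.
by rewrite ltr_wpDl ?sqr_ge0 // mulr_gt0 // exprn_even_gt0.
Qed.

Lemma posdef_det (R : realType) (A : 'M[R]_2) : posdef_mx A -> 0 < \det A.
Proof. by move=> /posdef2P[]. Qed.

Lemma posdef_inv_form (R : realType) (A : 'M[R]_2) (z : 'cV[R]_2) :
  posdef_mx A -> z != 0 -> 0 < (z^T *m invmx A *m z) 0 0.
Proof.
move=> /posdef2P[sA A0 dA] z0.
(* Up to the determinant, the form of the inverse is that of the adjugate. *)
pose B : 'M[R]_2 := \matrix_(i, j)
  (if i == 0 then if j == 0 then A 1 1 else - A 0 1
    else if j == 0 then - A 1 0 else A 0 0).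
have dB : \det B = \det A by rewrite !det2E !mxE /=; ring.
have A1 : 0 < A 1 1.
  have : 0 < A 0 0 * A 1 1.
    by apply: lt_le_trans dA _; rewrite det2E sA -expr2 gerBl sqr_ge0.
  by rewrite pmulr_rgt0.
have pB : posdef_mx B by apply/posdef2P; rewrite dB !mxE /= sA.
have := pB.2 z z0; rewrite inv_form2E ?gt_eqF // form2E !mxE /= => H.
rewrite divr_gt0 //; apply: lt_le_trans H _.
by rewrite le_eqVlt; apply/orP; left; apply/eqP; ring.
Qed.

(** An ellipse determines the matrix that defines it. *)
Lemma ellipse_of_inj (R : realType) (A B : 'M[R]_2) :
  posdef_mx A -> posdef_mx B -> ellipse_of A = ellipse_of B -> A = B.
Proof.
move=> pA pB AB.
have dA := posdef_det pA; have dB := posdef_det pB.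
(* Both forms are determined by their common level set 1, by homogeneity. *)
have form_eq (z : 'cV[R]_2) : (z^T *m invmx A *m z) 0 0 = (z^T *m invmx B *m z) 0 0.
  have [->|z0] := eqVneq z 0; first by rewrite !mulmx0.
  have c0 := posdef_inv_form pA z0.
  set c := (z^T *m invmx A *m z) 0 0 in c0 *.
  pose s := Num.sqrt c; have s0 : 0 < s by rewrite sqrtr_gt0.
  have s2 : s ^+ 2 = c by rewrite sqr_sqrtr // ltW.
  have scl (C : 'M[R]_2) : ((s^-1 *: z)^T *m C *m (s^-1 *: z)) 0 0
      = (z^T *m C *m z) 0 0 / c.
    by rewrite !form2E !mxE -s2 -exprVn; ring.
  have : ellipse_of A (s^-1 *: z).
    by rewrite /ellipse_of /= scl divff // gt_eqF.
  rewrite AB /ellipse_of /= scl => /(congr1 (fun x => x * c)).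
  by rewrite mul1r divfK // gt_eqF.
have [sA _ _] := (posdef2P A).1 pA; have [sB _ _] := (posdef2P B).1 pB.
have dA0 : \det A != 0 by rewrite gt_eqF.
have dB0 : \det B != 0 by rewrite gt_eqF.
have H x y : A 1 1 / \det A * x ^+ 2 - 2 * (A 0 1 / \det A) * (x * y)
    + A 0 0 / \det A * y ^+ 2 = B 1 1 / \det B * x ^+ 2
    - 2 * (B 0 1 / \det B) * (x * y) + B 0 0 / \det B * y ^+ 2.
  have := form_eq (vec2 x y); rewrite !inv_form2E // !mxE /= sA sB => E.
  by rewrite [LHS](_ : _ = (A 1 1 * x ^+ 2 - (A 0 1 + A 0 1) * (x * y)
    + A 0 0 * y ^+ 2) / \det A); [rewrite E; ring|ring].
have e1 : A 1 1 / \det A = B 1 1 / \det B by have := H 1 0; lra.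
have e0 : A 0 0 / \det A = B 0 0 / \det B by have := H 0 1; lra.
have e01 : A 0 1 / \det A = B 0 1 / \det B by have := H 1 1; lra.
(* The forms determine the matrices up to the determinant, which is itself the
   inverse of the determinant of the form. *)
have dinv (C : 'M[R]_2) : C 1 0 = C 0 1 -> \det C != 0 -> (\det C)^-1 =
    C 0 0 / \det C * (C 1 1 / \det C) - (C 0 1 / \det C) ^+ 2.
  move=> sC dC.
  have -> : C 0 0 / \det C * (C 1 1 / \det C) - (C 0 1 / \det C) ^+ 2 =
    (C 0 0 * C 1 1 - C 0 1 * C 1 0) / \det C / \det C by rewrite sC; ring.
  by rewrite -det2E divff // mul1r.
have dE : (\det A)^-1 = (\det B)^-1 by rewrite (dinv A) // e0 e1 e01 -dinv.
rewrite dE in e0 e1 e01.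
have i0 : (\det B)^-1 != 0 by rewrite invr_eq0.
by apply: M2P; rewrite ?sA ?sB; apply: (mulIf i0).
Qed.

Lemma ellipse_mxK (R : realType) (A : 'M[R]_2) :
  posdef_mx A -> ellipse_mx (ellipse_of A) = A.
Proof.
move=> pA; have : [set B | posdef_mx B /\ ellipse_of B = ellipse_of A] !=set0.
  by exists A.
by move/getPex => [pB BA]; exact: ellipse_of_inj.
Qed.

(** The matrix of the ellipse osculating, at the point [p], a curve with
    velocity [q] and second derivative [r] there: [p] and a multiple of [q] are
    conjugate radii of this ellipse. *)
Definition osc_mx (R : realType) (p q r : 'cV[R]_2) : 'M[R]_2 :=
  p *m p^T + (wedge p q / wedge q r) *: (q *m q^T).

Lemma osc_mxE (R : realType) (p q r : 'cV[R]_2) i j :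
  osc_mx p q r i j =
  p i 0 * p j 0 + wedge p q / wedge q r * (q i 0 * q j 0).
Proof. by rewrite mxE outerE mxE outerE. Qed.

Lemma det_osc_mx (R : realType) (p q r : 'cV[R]_2) :
  \det (osc_mx p q r) = wedge p q / wedge q r * wedge p q ^+ 2.
Proof.
rewrite det2E !osc_mxE; move: (_ / _) => m; rewrite wedgeE; ring.
Qed.

Lemma posdef_osc_mx (R : realType) (p q r : 'cV[R]_2) :
  0 < wedge p q -> 0 < wedge q r -> posdef_mx (osc_mx p q r).
Proof.
move=> pq qr; have m0 := divr_gt0 pq qr.
apply/posdef2P; split; last by rewrite det_osc_mx mulr_gt0 // exprn_gt0.
  by rewrite !osc_mxE (mulrC (p 1 0)) (mulrC (q 1 0)).
rewrite osc_mxE -!expr2.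
have [p0|p0] := eqVneq (p 0 0) 0; last first.
  apply: ltr_wpDr; last by rewrite exprn_even_gt0.
  by rewrite mulr_ge0 ?sqr_ge0 ?(ltW m0).
rewrite p0 expr0n add0r mulr_gt0 // exprn_even_gt0 //=.
by apply: contraTneq pq => q0; rewrite wedgeE p0 q0 !mul0r subrr ltxx.
Qed.

Lemma osc_ellipseE (R : realType) (p q r z : 'cV[R]_2) :
  0 < wedge p q -> 0 < wedge q r ->
  ellipse_of (osc_mx p q r) z <->
  wedge z q ^+ 2 + wedge q r / wedge p q * wedge p z ^+ 2 = wedge p q ^+ 2.
Proof.
move=> pq qr; have pA := posdef_osc_mx pq qr; have dA := posdef_det pA.
rewrite /ellipse_of /= inv_form2E ?gt_eqF //.
set N := _ + _ * z 1 0 ^+ 2.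
have -> : N = wedge p q / wedge q r *
   (wedge z q ^+ 2 + wedge q r / wedge p q * wedge p z ^+ 2).
  have q0 : wedge q r != 0 by rewrite gt_eqF.
  have p0 : wedge p q != 0 by rewrite gt_eqF.
  have mm : wedge p q / wedge q r * (wedge q r / wedge p q) = 1.
    by field; apply/andP.
  rewrite mulrDr [_ * (_ / _ * _)]mulrA mm mul1r /N !osc_mxE.
  move: (_ / _) => m; rewrite !wedgeE; ring.
have m0 := divr_gt0 pq qr; have m1 : wedge p q / wedge q r != 0 by rewrite gt_eqF.
have w2 : wedge p q ^+ 2 != 0 by rewrite expf_neq0 // gt_eqF.
rewrite det_osc_mx -mulf_div divff // mul1r.
split=> [/(congr1 (fun x => x * wedge p q ^+ 2))|->]; last by rewrite divff.
by rewrite mul1r divfK.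
Qed.

(** The trigonometric parametrizations of ellipses centered at 0, with
    conjugate radii [p] and [q]. *)
Definition trig_ellipse (R : realType) (p q : 'cV[R]_2) (t : R) : 'cV[R]_2 :=
  cos t *: p + sin t *: q.

Lemma is_derive_trig_ellipse (R : realType) (p q : 'cV[R]_2) t :
  derivable (trig_ellipse p q) t 1 /\
  (trig_ellipse p q)^`() t = trig_ellipse q (- p) t.
Proof.
have dij i j : is_derive t 1 (fun t => trig_ellipse p q t i j)
   (trig_ellipse q (- p) t i j).
  have := is_deriveD (is_deriveZ (p i j) (is_derive_cos t))
    (is_deriveZ (q i j) (is_derive_sin t)).
  rewrite (_ : _ *: - sin t + _ = trig_ellipse q (- p) t i j).
    rewrite (_ : _ + _ = fun t => trig_ellipse p q t i j) //.
    by apply/funext => u; rewrite /trig_ellipse !mxE mulrC [sin u * _]mulrC.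
  by rewrite /trig_ellipse !mxE /GRing.scale /=; ring.
have d : derivable (trig_ellipse p q) t 1.
  by apply/derivable_mxP => i j; apply: ex_derive; exact: dij.
split=> //; apply/matrixP => i j; have [_ E] := dij i j.
by rewrite (derive1_mxE _ _ d) [LHS]derive1E [LHS]E.
Qed.

Lemma derive_trig_ellipse (R : realType) (p q : 'cV[R]_2) :
  (trig_ellipse p q)^`() = trig_ellipse q (- p).
Proof. by apply/funext => t; have [] := is_derive_trig_ellipse p q t. Qed.

Lemma Ck_trig_ellipse (R : realType) k (p q : 'cV[R]_2) :
  Ck k setT (trig_ellipse p q).
Proof.
elim: k p q => [|k IH] p q.
  move=> t _; apply: differentiable_continuous; apply/derivable1_diffP.
  by have [] := is_derive_trig_ellipse p q t.
apply/(CkS_derive1 _ _ openT); split=> [t _|].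
  by have [] := is_derive_trig_ellipse p q t.
by rewrite derive_trig_ellipse; exact: IH.
Qed.

Lemma unit_circle_cos_sin (R : realType) (x y : R) :
  x ^+ 2 + y ^+ 2 = 1 -> exists t, cos t = x /\ sin t = y.
Proof.
move=> xy.
have x1 : -1 <= x <= 1.
  rewrite -ler_norml -(@ler_pXn2r _ 2) ?nnegrE // expr1n real_normK ?num_real //.
  by rewrite -xy lerDl sqr_ge0.
have y2 : 1 - x ^+ 2 = y ^+ 2 by rewrite -xy addrC addKr.
have [y0|y0] := leP 0 y.
  exists (acos x); rewrite acosK ?in_itv //= sin_acos // y2 sqrtr_sqr.
  by rewrite ger0_norm.
exists (- acos x); rewrite cosN sinN acosK ?in_itv //= sin_acos // y2 sqrtr_sqr.
by rewrite ltr0_norm // opprK.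
Qed.

(** * The osculating ellipse *)

Lemma is_derive_mx_entry (R : realType) m n (f : R -> 'M[R]_(m, n)) t i j :
  derivable f t 1 -> is_derive t 1 (fun s => f s i j) (f^`() t i j).
Proof.
move=> df; rewrite (derive1_mxE _ _ df) derive1E; apply: derivableP.
exact: ((derivable_mxP _ _ _).1 df).
Qed.

(** The symmetric bilinear form of the plane with diagonal matrix entries [a]
    and [c] and off-diagonal entry [b]. *)
Definition sform (R : realType) (a b c : R) (u v : 'cV[R]_2) : R :=
  a * (u 0 0 * v 0 0) + b * (u 0 0 * v 1 0 + u 1 0 * v 0 0)
    + c * (u 1 0 * v 1 0).

Lemma is_derive_sform (R : realType) (a b c : R) (u v : R -> 'cV[R]_2)
    (t : R) (du dv : 'cV[R]_2) :
  (forall i, is_derive t 1 (fun s => u s i 0) (du i 0)) ->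
  (forall i, is_derive t 1 (fun s => v s i 0) (dv i 0)) ->
  is_derive t 1 (fun s => sform a b c (u s) (v s))
    (sform a b c du (v t) + sform a b c (u t) dv).
Proof.
move=> Du Dv; have d i j := is_deriveM (Du i) (Dv j).
have H := is_deriveD (is_deriveD (is_deriveZ a (d 0 0))
  (is_deriveZ b (is_deriveD (d 0 1) (d 1 0)))) (is_deriveZ c (d 1 1)).
apply: (is_derive_eq H); rewrite /sform /GRing.scale /=; ring.
Qed.

(** The first two derivatives of a quadratic form that is constant along a
    curve. *)
Lemma sform_constant (R : realType) (a b c k : R) (e : R -> 'cV[R]_2) :
  smooth_on setT e -> (forall t, sform a b c (e t) (e t) = k) ->
  forall t, sform a b c (e t) (e^`() t) = 0 /\
    sform a b c (e^`() t) (e^`() t) + sform a b c (e t) (e^`(2) t) = 0.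
Proof.
move=> eS eE.
have de t : derivable e t 1 := @Ck_derivable _ _ 2 _ _ _ openT eS I.
have de' t : derivable e^`() t 1 :=
  @Ck_derivable _ _ 1 _ _ _ openT (@Ck_derive1 _ _ 2 _ _ openT eS) I.
have d t i := is_derive_mx_entry i 0 (de t).
have d' t i := is_derive_mx_entry i 0 (de' t).
have constD (f : R -> R) r (t l : R) :
    (forall s, f s = r :> R) -> is_derive t 1 f l -> l = 0.
  move=> fr [_ <-]; rewrite (_ : f = cst r) ?derive_cst //.
  by apply/funext => s; rewrite fr.
have E1 t : sform a b c (e t) (e^`() t) = 0.
  have := constD _ _ t _ eE (is_derive_sform a b c (d t) (d t)).
  move: (e t) (e^`() t) => u v; rewrite /sform; lra.
move=> t; split; first exact: E1.
exact: constD E1 (is_derive_sform a b c (d t) (d' t)).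
Qed.

Lemma euclid_norm_gt0 (R : realType) (v : 'cV[R]_2) : v != 0 -> 0 < euclid_norm v.
Proof.
move=> v0; rewrite sqrtr_gt0 sum2E lt_neqAle addr_ge0 ?sqr_ge0 // andbT eq_sym.
apply: contra v0; rewrite paddr_eq0 ?sqr_ge0 // !sqrf_eq0 => /andP[/eqP a /eqP b].
by apply/eqP/cV2P; rewrite mxE.
Qed.

Lemma euclid_normZ (R : realType) s (v : 'cV[R]_2) : 0 < s ->
  euclid_norm (s *: v) = s * euclid_norm v.
Proof.
move=> s0; rewrite /euclid_norm !sum2E !mxE !exprMn -mulrDr.
by rewrite sqrtrM ?sqr_ge0 // sqrtr_sqr gtr0_norm.
Qed.

(** Let a symmetric form be constantly 1, to second order, along a curve with
    position [p], velocity [s *: q] and second derivative [e2]. If this curve has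
    the same Euclidean curvature as a curve with velocity [q] and second
    derivative [r], then [p], [q] and [r] determine the form: the vectors [p] and
    [q] are orthogonal, of squares 1 and [wedge q r / wedge p q]. *)
Lemma osculating_form (R : realType) (a b c s : R) (p q r e2 z : 'cV[R]_2) :
  0 < wedge p q -> 0 < s -> sform a b c p p = 1 -> sform a b c p (s *: q) = 0 ->
  sform a b c (s *: q) (s *: q) + sform a b c p e2 = 0 ->
  wedge (s *: q) e2 / euclid_norm (s *: q) ^+ 3 =
    wedge q r / euclid_norm q ^+ 3 ->
  wedge p q ^+ 2 * sform a b c z z =
    wedge z q ^+ 2 + wedge q r / wedge p q * wedge p z ^+ 2.
Proof.
move=> pq s0 Spp D1 D2 eC.
have n0 := euclid_norm_gt0 (wedge_neq0r pq).
have s1 : s != 0 by rewrite gt_eqF.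
have p0 : wedge p q != 0 by rewrite gt_eqF.
have qe : wedge q e2 = s ^+ 2 * wedge q r.
  move: eC; rewrite wedgeZl euclid_normZ //; move: (euclid_norm q) n0 => n n0.
  have n1 : n != 0 by rewrite gt_eqF.
  move=> /eqP; rewrite eqr_div ?expf_neq0 ?mulf_neq0 // => /eqP H.
  apply: (@mulfI _ (s * n ^+ 3)); first by rewrite mulf_neq0 ?expf_neq0.
  transitivity (s * wedge q e2 * n ^+ 3); first by ring.
  by rewrite H; ring.
have Spq : sform a b c p q = 0.
  by apply: (mulfI s1); rewrite mulr0 -D1 /sform !mxE; ring.
have Sqq : s ^+ 2 * sform a b c q q + sform a b c p e2 = 0.
  by rewrite -D2 /sform !mxE; ring.
have Spe : wedge p q * sform a b c p e2 = - wedge q e2.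
  transitivity (wedge e2 q * sform a b c p p + wedge p e2 * sform a b c p q).
    by rewrite /sform !wedgeE; ring.
  by rewrite Spp Spq wedgeC; ring.
have {}Sqq : sform a b c q q = wedge q r / wedge p q.
  apply: (mulfI (mulf_neq0 p0 (expf_neq0 2 s1))).
  transitivity (wedge p q * (s ^+ 2 * sform a b c q q + sform a b c p e2)
    - wedge p q * sform a b c p e2); first by ring.
  by rewrite Sqq Spe qe; field.
(* Up to the factor [wedge p q], the coordinates of [z] in the basis [p], [q]
   are [wedge z q] and [wedge p z]. *)
transitivity (wedge z q ^+ 2 * sform a b c p p
    + 2 * wedge z q * wedge p z * sform a b c p q
    + wedge p z ^+ 2 * sform a b c q q).
  by rewrite /sform !wedgeE; ring.
by rewrite Spp Spq Sqq; ring.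
Qed.

Lemma posdef_inv_formE (R : realType) (A : 'M[R]_2) (z : 'cV[R]_2) :
  posdef_mx A -> (z^T *m invmx A *m z) 0 0 =
    sform (A 1 1 / \det A) (- (A 0 1 / \det A)) (A 0 0 / \det A) z z.
Proof.
move=> pA; have [sA _ dA] := (posdef2P A).1 pA.
rewrite inv_form2E ?gt_eqF // sA /sform; move: (\det A) => d; ring.
Qed.

Lemma osculates_uniq (R : realType) (a : R -> 'cV[R]_2) (t : R) (E : set 'cV[R]_2) :
  0 < wedge (a t) (a^`() t) -> 0 < wedge (a^`() t) (a^`(2) t) ->
  osculates a t E -> E = ellipse_of (osc_mx (a t) (a^`() t) (a^`(2) t)).
Proof.
move=> pq qr [[B pB EB] [e [[eS eE eW] e0 [s e'0] eC]]].
have eW0 := eW 0; move: eC eW0; rewrite /euclid_curvature.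
have Qe u : sform (B 1 1 / \det B) (- (B 0 1 / \det B)) (B 0 0 / \det B)
    (e u) (e u) = 1.
  rewrite -posdef_inv_formE //.
  by have : E (e u); [rewrite -eE; exists u|rewrite EB].
have [] := sform_constant eS Qe 0; have := Qe 0.
rewrite e'0 e0; move: (e^`(2) 0) (a t) (a^`() t) (a^`(2) t) pq qr.
move=> e2 p q r pq qr Spp D1 D2 eC.
rewrite wedgeZr pmulr_lgt0 // => s0.
have H z := osculating_form z pq s0 Spp D1 D2 eC.
have w2 : wedge p q ^+ 2 != 0 by rewrite expf_neq0 // gt_eqF.
apply/seteqP; split=> z; rewrite EB osc_ellipseE // /ellipse_of /= posdef_inv_formE // -H.
  by move=> ->; rewrite mulr1.
by move=> /(canRL (mulKf w2)) ->; rewrite mulVf.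
Qed.

Lemma osculates_exists (R : realType) (a : R -> 'cV[R]_2) (t : R) :
  0 < wedge (a t) (a^`() t) -> 0 < wedge (a^`() t) (a^`(2) t) ->
  osculates a t (ellipse_of (osc_mx (a t) (a^`() t) (a^`(2) t))).
Proof.
rewrite /osculates /euclid_curvature.
move: (a t) (a^`() t) (a^`(2) t) => p q r pq qr.
have m0 := divr_gt0 pq qr; set m := _ / _ in m0.
have p0 : wedge p q != 0 by rewrite gt_eqF.
have r0 : wedge q r != 0 by rewrite gt_eqF.
(* The radius conjugate to [p] is [s *: q], by the curvature condition. *)
pose s := Num.sqrt m; have s0 : 0 < s by rewrite sqrtr_gt0.
have s2 : s ^+ 2 = m by rewrite sqr_sqrtr // ltW.
split; first by exists (osc_mx p q r) => //; exact: posdef_osc_mx.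
exists (trig_ellipse p (s *: q)); split.
- split; first exact: Ck_trig_ellipse.
  + apply/seteqP; split=> z.
      case=> u _ <-; apply/osc_ellipseE => //.
      have -> : wedge (trig_ellipse p (s *: q) u) q = cos u * wedge p q.
        by rewrite /trig_ellipse !wedgeE !mxE; ring.
      have -> : wedge p (trig_ellipse p (s *: q) u) = sin u * s * wedge p q.
        by rewrite /trig_ellipse !wedgeE !mxE; ring.
      rewrite !exprMn s2 -[RHS]mul1r -(cos2Dsin2 u) /m; field; exact/andP.
    move=> /osc_ellipseE => /(_ pq qr) H.
    have [|u [cu su]] := @unit_circle_cos_sin _ (wedge z q / wedge p q)
        (wedge p z / (s * wedge p q)).
      rewrite -(@divff _ (wedge p q ^+ 2)) ?expf_neq0 // -[X in _ = X / _]H.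
      rewrite !expr_div_n exprMn s2 /m; field; exact/andP.
    exists u => //; rewrite /trig_ellipse cu su.
    have s1 : s != 0 by rewrite gt_eqF.
    by apply: cV2P; rewrite !mxE !wedgeE; rewrite wedgeE in p0; field;
      apply/andP.
  + move=> u; rewrite derive_trig_ellipse.
    have -> : wedge (trig_ellipse p (s *: q) u) (trig_ellipse (s *: q) (- p) u)
      = (cos u ^+ 2 + sin u ^+ 2) * (s * wedge p q).
      by rewrite /trig_ellipse !wedgeE !mxE; ring.
    by rewrite cos2Dsin2 mul1r mulr_gt0.
- by rewrite /trig_ellipse cos0 sin0 scale1r scale0r addr0.
- exists s; rewrite derive_trig_ellipse.
  by rewrite /trig_ellipse cos0 sin0 scale1r scale0r addr0.
- rewrite derive1nS derive1n1 !derive_trig_ellipse.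
  rewrite /trig_ellipse cos0 sin0 !scale1r !scale0r !addr0.
  have n0 := euclid_norm_gt0 (wedge_neq0r pq).
  rewrite euclid_normZ // wedgeZl (_ : wedge q (- p) = wedge p q); last first.
    by rewrite !wedgeE !mxE; ring.
  have -> : s * wedge p q = s ^+ 3 * wedge q r.
    by rewrite exprSr s2 /m; field.
  by field; rewrite !gt_eqF.
Qed.

Lemma osc_curveE (R : realType) (a : R -> 'cV[R]_2) (t : R) :
  0 < wedge (a t) (a^`() t) -> 0 < wedge (a^`() t) (a^`(2) t) ->
  osc_curve a t = osc_mx (a t) (a^`() t) (a^`(2) t).
Proof.
move=> pq qr; rewrite /osc_curve.
have -> : osculating_ellipse a t =
    ellipse_of (osc_mx (a t) (a^`() t) (a^`(2) t)).
  apply: osculates_uniq => //; apply: (@getPex _ (osculates a t)).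
  by eexists; exact: osculates_exists.
by rewrite ellipse_mxK //; exact: posdef_osc_mx.
Qed.

(** * The Levi-Civita connection on the space of ellipses *)

Lemma sqnormE (R : realType) (A X : 'M[R]_2) : sqnorm A X = - (\det X / \det A).
Proof. by rewrite /sqnorm det_mulmx det_inv mulrC. Qed.

(** The polar form of the determinant of matrices of size 2. *)
Definition polar_det (R : realType) (X Y : 'M[R]_2) : R :=
  X 0 0 * Y 1 1 + X 1 1 * Y 0 0 - X 0 1 * Y 1 0 - X 1 0 * Y 0 1.

Lemma metricE (R : realType) (A X Y : 'M[R]_2) :
  metric A X Y = - (2^-1 * polar_det X Y) / \det A.
Proof.
rewrite /metric !sqnormE; move: (\det A) => d.
by rewrite !det2E !mxE /polar_det; ring.
Qed.

Lemma is_derive_entry (R : realType) m n (A Z : 'M[R]_(m, n)) i j :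
  is_derive A Z (fun B : 'M[R]_(m, n) => B i j : R) (Z i j).
Proof.
have d : derivable (id : 'M[R]_(m, n) -> 'M[R]_(m, n)) A Z.
  exact: derivable_id.
have dij : derivable (fun B : 'M[R]_(m, n) => B i j : R) A Z.
  exact: ((derivable_mxP _ _ _).1 d).
apply: DeriveDef => //.
have := derive_mx d; rewrite derive_id => /matrixP /(_ i j).
by rewrite mxE.
Qed.

Lemma is_derive_det2 (R : realType) (A Z : 'M[R]_2) :
  is_derive A Z (fun B : 'M[R]_2 => \det B : R) (polar_det A Z).
Proof.
have d := @is_derive_entry R 2 2 A Z.
have H := is_deriveB (is_deriveM (d 0 0) (d 1 1)) (is_deriveM (d 0 1) (d 1 0)).
rewrite (_ : (fun B : 'M[R]_2 => _) = (fun B : 'M[R]_2 => B 0 0) * (fun B => B 1 1)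
  - (fun B : 'M[R]_2 => B 0 1) * (fun B => B 1 0)).
  by apply: (is_derive_eq H); rewrite /GRing.scale /= /polar_det; ring.
by apply/funext => B; rewrite det2E.
Qed.

Lemma derive_metric (R : realType) (A X Y Z : 'M[R]_2) : \det A != 0 ->
  'D_Z (fun B => metric B X Y : R) A =
    2^-1 * polar_det X Y * polar_det A Z / \det A ^+ 2.
Proof.
move=> dA.
rewrite (_ : (fun B => _) = (- (2^-1 * polar_det X Y)) \*:
   (fun B : 'M[R]_2 => (\det B)^-1 : R)); last first.
  by apply/funext => B; rewrite metricE.
have [dd dE] := is_derive_det2 A Z.
rewrite deriveZ; last exact: derivableV.
rewrite deriveV // dE /GRing.scale /=; move: (\det A) => d; ring.
Qed.

Lemma sym_mxP (R : realType) (X : 'M[R]_2) : sym_mx X <-> X 1 0 = X 0 1.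
Proof.
split=> [/matrixP /(_ 0 1)|s]; first by rewrite mxE.
by apply: M2P; rewrite mxE.
Qed.

(** The Christoffel tensor of the metric -det(A^-1 X), a conformal multiple of
    the flat Lorentz metric -det X. *)
Definition christoffel (R : realType) (A X Y : 'M[R]_2) : 'M[R]_2 :=
  - (2 * \det A)^-1 *:
    (polar_det A X *: Y + polar_det A Y *: X - polar_det X Y *: A).

Lemma christoffel_levi_civita (R : realType) : is_levi_civita (@christoffel R).
Proof.
move=> A /posdef2P[sA A0 dA]; have d0 : \det A != 0 by rewrite gt_eqF.
split.
- by move=> X Y /sym_mxP sX /sym_mxP sY; apply/sym_mxP; rewrite !mxE sX sY sA.
- move=> r X Y Z _ _ _; rewrite /christoffel; move: (_^-1) => d.
  by split; apply/matrixP => i j; rewrite !mxE /polar_det !mxE; ring.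
- move=> X Y _ _; rewrite /christoffel; move: (_^-1) => d.
  by apply/matrixP => i j; rewrite !mxE /polar_det; ring.
- move=> X Y Z _ _ _; rewrite derive_metric // !metricE.
  have E U V W : polar_det (christoffel A U V) W = - (2 * \det A)^-1 *
     (polar_det A U * polar_det V W + polar_det A V * polar_det U W
      - polar_det U V * polar_det A W).
    rewrite /christoffel; move: (_^-1) => d.
    by rewrite /polar_det !mxE; ring.
  have C (U V : 'M[R]_2) : polar_det U V = polar_det V U by rewrite /polar_det; ring.
  rewrite (C X (christoffel A Z Y)) !E (C Y X).
  move: (polar_det X Y) (polar_det A X) (polar_det A Y) (polar_det A Z)
    (polar_det Z X) (polar_det Z Y) => *; move: (\det A) d0 => d d0.
  by field.
Qed.

Lemma polar_det_nondegenerate (R : realType) (X : 'M[R]_2) : sym_mx X ->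
  (forall Y, sym_mx Y -> polar_det X Y = 0) -> X = 0.
Proof.
move=> /sym_mxP sX H.
pose D (x y z : R) : 'M[R]_2 := \matrix_(i, j)
  (if i == 0 then if j == 0 then x else y else if j == 0 then y else z).
have sD x y z : sym_mx (D x y z) by apply/sym_mxP; rewrite !mxE.
have := H _ (sD 1 0 0); have := H _ (sD 0 1 0); have := H _ (sD 0 0 1).
rewrite /polar_det !mxE /= sX => h1 h2 h3.
by apply: M2P; rewrite !mxE ?sX; lra.
Qed.

(** Uniqueness of the Levi-Civita connection, by Koszul's argument: the
    difference [T] of two such tensors makes [polar_det (T X Y) Z] symmetric in
    [X], [Y] and antisymmetric in [Y], [Z]. *)
Lemma levi_civita_uniq (R : realType) G (A X Y : 'M[R]_2) :
  is_levi_civita G -> posdef_mx A -> sym_mx X -> sym_mx Y ->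
  G A X Y = christoffel A X Y.
Proof.
move=> GL pA sX sY.
have [Gs _ Gc Gm] := GL A pA.
have [Cs _ Cc Cm] := christoffel_levi_civita pA.
have d0 : \det A != 0 by rewrite gt_eqF // posdef_det.
pose T U V := G A U V - christoffel A U V.
have sT U V : sym_mx U -> sym_mx V -> sym_mx (T U V).
  move=> sU sV; have := Cs _ _ sU sV; have := Gs _ _ sU sV; rewrite /T.
  move: (G A U V) (christoffel A U V) => M N /sym_mxP h1 /sym_mxP h2.
  by apply/sym_mxP; rewrite !mxE h1 h2.
have Tc U V : sym_mx U -> sym_mx V -> T U V = T V U.
  by move=> sU sV; rewrite /T Gc // Cc.
have PC (U V : 'M[R]_2) : polar_det U V = polar_det V U by rewrite /polar_det; ring.
have Tm U V W : sym_mx U -> sym_mx V -> sym_mx W ->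
    polar_det (T U V) W = - polar_det (T U W) V.
  move=> sU sV sW; have := Gm V W U sV sW sU; rewrite (Cm V W U sV sW sU).
  rewrite !metricE -!mulrDl => /(mulIf (invr_neq0 d0)).
  rewrite (PC V) (PC V (G A U W)) => H.
  have PB (M N K : 'M[R]_2) : polar_det (M - N) K = polar_det M K - polar_det N K.
    by rewrite /polar_det !mxE; ring.
  rewrite /T !PB; lra.
apply/eqP; rewrite -subr_eq0; apply/eqP.
apply: polar_det_nondegenerate; first exact: sT.
move=> Z sZ; rewrite -/(T X Y).
have h : polar_det (T X Y) Z = - polar_det (T X Y) Z.
  rewrite {1}Tm // [T X Z]Tc // Tm // [T Z Y]Tc // Tm // [T Y X]Tc //.
  by rewrite !opprK.
lra.
Qed.

Lemma levi_civitaE (R : realType) (A X Y : 'M[R]_2) :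
  posdef_mx A -> sym_mx X -> sym_mx Y ->
  levi_civita A X Y = christoffel A X Y.
Proof.
apply: levi_civita_uniq; apply: (@getPex _ (@is_levi_civita R)).
by exists (@christoffel R); exact: christoffel_levi_civita.
Qed.

(** For a null vector [X], the Christoffel term is a multiple of [X], so it does
    not contribute to the norm of an acceleration [Y] orthogonal to [X]. *)
Lemma sqnorm_null_acceleration (R : realType) (A X Y : 'M[R]_2) :
  posdef_mx A -> sym_mx X -> \det X = 0 -> polar_det X Y = 0 ->
  sqnorm A (Y + levi_civita A X X) = - (\det Y / \det A).
Proof.
move=> pA sX dX XY; rewrite sqnormE levi_civitaE // /christoffel.
have -> : polar_det X X = 2 * \det X by rewrite det2E /polar_det; ring.
rewrite dX mulr0 scale0r subr0 -scalerDl scalerA; set m : R := (X in X *: _).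
have -> : \det (Y + m *: X) = \det Y + m * polar_det X Y + m ^+ 2 * \det X.
  by rewrite !det2E /polar_det !mxE; ring.
by rewrite dX XY !mulr0 !addr0.
Qed.

(** * Standard centro-affine parametrizations *)

Lemma is_derive_derive1_eq (R : realType) m n (f : R -> 'M[R]_(m, n)) (t : R)
    (l : 'M[R]_(m, n)) :
  (forall i j, is_derive t 1 (fun s => f s i j) (l i j)) ->
  derivable f t 1 /\ f^`() t = l.
Proof.
move=> fl; have df : derivable f t 1.
  by apply/derivable_mxP => i j; apply: ex_derive; exact: fl.
split=> //; apply/matrixP => i j; rewrite (derive1_mxE _ _ df) derive1E.
by have [_] := fl i j.
Qed.

Lemma derive1_scale_curve (R : realType) n (f : R -> R) (v : R -> 'cV[R]_n) t :
  derivable f t 1 -> derivable v t 1 ->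
  (fun s => f s *: v s)^`() t = f^`() t *: v t + f t *: v^`() t.
Proof.
move=> df dv; have [|_ //] := @is_derive_derive1_eq R n 1 (fun s => f s *: v s) t
  (f^`() t *: v t + f t *: v^`() t).
move=> i j; rewrite ord1; have d := derivableP df; rewrite -derive1E in d.
have H := is_deriveM d (is_derive_mx_entry i 0 dv).
rewrite (_ : (fun s => _) = f * (fun s => v s i 0)).
  by apply: (is_derive_eq H); rewrite !mxE /GRing.scale /= [RHS]addrC
    [X in _ = _ + X]mulrC.
by apply/funext => s; rewrite mxE.
Qed.

Lemma wedge_reparam12 (R : realType) (q r : 'cV[R]_2) (s s2 : R) :
  wedge (s *: q) (s2 *: q + s ^+ 2 *: r) = s ^+ 3 * wedge q r.
Proof. by rewrite !wedgeE !mxE; ring. Qed.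

(** Any two parametrizations of a path differ by an orientation preserving
    change of parameter. *)
Lemma parametrization_factor (R : realType) (c : oriented_set R)
    (I J : set R) (a f : R -> 'cV[R]_2) :
  is_orientation c -> parametrization c I a -> parametrization c J f ->
  exists phi : R -> R, forall t, J t ->
    [/\ I (phi t), f t = a (phi t), derivable phi t 1, 0 < phi^`() t
      & f^`() t = phi^`() t *: a^`() (phi t)].
Proof.
move=> oc [[oI _] ea aI pa] [[oJ _] ef fJ pf].
have [||phi H] := @embedding_factor R 2 I J a f oI ea oJ.
- by case: ef.
- by rewrite aI fJ.
exists phi => t Jt; have [Ip fE _ dphi f'E] := H t Jt; split=> //.
have cft : carrier c (f t) by rewrite -fJ; exists t.
have [U [w [oU Uft _ /(_ _ cft Uft)[_ w0 pE]]]] := oc _ cft.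
(* Both velocities lie on the positive ray spanned by [w (f t)]. *)
have := pf t Jt; rewrite pE => -[s /= s0 sE].
have := pa _ Ip; rewrite -fE pE => -[r /= r0 rE].
move: f'E; rewrite -sE -rE scalerA => /eqP; rewrite -subr_eq0 -scalerBl.
rewrite scaler_eq0 (negbTE w0) orbF subr_eq0 => /eqP sr.
by move: s0; rewrite sr pmulr_lgt0.
Qed.

(** Standard centro-affine parametrizations, together with the positivity of
    the area spanned by position and velocity. *)
Definition centro_frame (R : realType) (c : oriented_set R) (I : set R)
    (a : R -> 'cV[R]_2) (k : R -> R) : Prop :=
  std_centro_affine c I a k /\ forall t, I t -> 0 < wedge (a t) (a^`() t).

Section CentroFrame.
Context {R : realType} (c : oriented_set R) (I : set R) (a : R -> 'cV[R]_2)
  (k : R -> R).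
Hypotheses (oc : is_orientation c) (fr : centro_frame c I a k).

Let par : parametrization c I a. Proof. by case: fr => -[]. Qed.
Let oI : open I. Proof. by case: par => -[]. Qed.
Let Ck_a : Ck 3 I a. Proof. by case: par => _ []. Qed.
Let Ck_k : Ck 3 I k. Proof. by case: fr => -[]. Qed.
Let ode t : I t -> a^`(2) t = - a t + (2^-1 * k t) *: a^`() t.
Proof. by case: fr => -[_ _ + _]; exact. Qed.
Let W_gt0 t : I t -> 0 < wedge (a t) (a^`() t).
Proof. by case: fr => _; exact. Qed.

(* The defining equation improves the regularity of [a] by one. *)
Let Ck_a' : Ck 3 I a^`().
Proof.
have a2 : Ck 2 I a^`() by exact: Ck_derive1.
apply/(CkS_derive1 _ _ oI); split=> [t It|].
  exact: (@Ck_derivable _ _ 1 _ _ _ oI a2 It).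
apply: (@Ck_eq _ _ _ _ _ (fun t => - a t + (2^-1 * k t) *: a^`() t) _ oI).
  by move=> t It; exact: esym (ode It).
apply/(Ck_mxP _ _ oI) => i j.
have ai := (Ck_mxP _ _ oI).1 (CkW Ck_a) i j.
have a'i := (Ck_mxP _ _ oI).1 a2 i j.
have := CkD oI (CkZ (-1) oI ai) (CkM oI (CkZ 2^-1 oI (CkW Ck_k)) a'i).
by apply: (Ck_eq oI) => t _; rewrite !mxE /GRing.scale /= mulN1r.
Qed.

Let der_a t : I t -> derivable a t 1.
Proof. exact: (@Ck_derivable _ _ 2). Qed.
Let der_a' t : I t -> derivable a^`() t 1.
Proof. exact: (@Ck_derivable _ _ 2). Qed.

Lemma centro_frame_wedge12 t : I t ->
  wedge (a^`() t) (a^`(2) t) = wedge (a t) (a^`() t).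
Proof. by move=> It; rewrite ode // !wedgeE !mxE; ring. Qed.

Lemma centro_frame_wedge02 t : I t ->
  wedge (a t) (a^`(2) t) = 2^-1 * k t * wedge (a t) (a^`() t).
Proof. by move=> It; rewrite ode // !wedgeE !mxE; ring. Qed.

(** The change of parameter to a standard centro-affine parametrization is of
    class [C^3], because its derivative is the quotient of the area [f /\ f'] by
    the area [a /\ a'], taken along [phi]. *)
Lemma parametrization_frame_factor (J : set R) (f : R -> 'cV[R]_2) :
  parametrization c J f ->
  exists phi : R -> R, Ck 3 J phi /\ forall t, J t ->
    [/\ I (phi t), f t = a (phi t), 0 < phi^`() t,
        f^`() t = phi^`() t *: a^`() (phi t)
      & f^`(2) t = phi^`(2) t *: a^`() (phi t)
                   + phi^`() t ^+ 2 *: a^`(2) (phi t)].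
Proof.
move=> pf; have [phi H] := parametrization_factor oc par pf.
have oJ : open J by case: pf => -[].
have Ck_f : Ck 3 J f by case: pf => _ [].
exists phi.
have IJ t : J t -> I (phi t) by move=> /H[].
have Ck_W : Ck 2 I (fun u => wedge (a u) (a^`() u)).
  exact: (Ck_wedge oI (CkW Ck_a) (CkW Ck_a')).
have step j : (j <= 2)%N -> Ck j J phi -> Ck j.+1 J phi.
  move=> j2 phij; apply/(CkS_derive1 _ _ oJ); split=> [t /H[]//|].
  have wj : Ck j J (fun t => wedge (f t) (f^`() t)).
    exact: (Ck_le j2 (Ck_wedge oJ (CkW Ck_f) (Ck_derive1 oJ Ck_f))).
  have Wphi := Ck_comp oJ oI IJ (Ck_le j2 Ck_W) phij.
  have W0 t : J t -> wedge (a (phi t)) (a^`() (phi t)) != 0.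
    by move=> /IJ Ip; rewrite gt_eqF // W_gt0.
  have := CkM oJ wj (CkV oJ W0 Wphi).
  apply: (Ck_eq oJ) => t Jt; have [_ -> _ _ ->] := H t Jt.
  by rewrite wedgeZr mulfK // W0.
have Ck_phi : Ck 3 J phi.
  apply: (step 2%N isT); apply: (step 1%N isT); apply: (step 0%N isT).
  move=> t Jt; apply: differentiable_continuous; apply/derivable1_diffP.
  by have [] := H t Jt.
split=> // t Jt; have [Ip fE dphi phi0 f'E] := H t Jt; split=> //.
have Ck_phi' : Ck 2 J phi^`() by exact: Ck_derive1.
have dphi' : derivable phi^`() t 1 := @Ck_derivable _ _ 1 _ _ _ oJ Ck_phi' Jt.
have [da'phi a'phiE] := is_derive_curve_comp dphi (der_a' Ip).
rewrite derive1nS derive1n1.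
transitivity ((fun s => phi^`() s *: (a^`() \o phi) s)^`() t).
  rewrite !derive1E; apply: near_eq_derive.
  by apply: filterS (open_near oJ Jt) => s /H[].
by rewrite (derive1_scale_curve dphi' da'phi) a'phiE scalerA -expr2.
Qed.

(** The matrix of the ellipse with conjugate radii [a u] and [a' u]. *)
Definition frame_mx (u : R) : 'M[R]_2 :=
  a u *m (a u)^T + a^`() u *m (a^`() u)^T.

Lemma frame_mxE u i j :
  frame_mx u i j = a u i 0 * a u j 0 + a^`() u i 0 * a^`() u j 0.
Proof. by rewrite mxE !outerE. Qed.

(** If a path has a frame, then all its parametrizations are 0-convex. *)
Lemma parametrization_convex (J : set R) (f : R -> 'cV[R]_2) :
  parametrization c J f -> convex0_curve J f.
Proof.
move=> /parametrization_frame_factor[phi [_ H]] t /H[Ip -> phi0 -> ->].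
have W0 := W_gt0 Ip.
rewrite wedge_reparam12 (centro_frame_wedge12 Ip) wedgeZr.
by split; apply: mulr_gt0 => //; exact: exprn_gt0.
Qed.

(** The ellipses osculating any parametrization are those of the standard one,
    taken along the change of parameter. *)
Lemma osc_curve_factor (J : set R) (f : R -> 'cV[R]_2) (phi : R -> R) t :
  I (phi t) -> f t = a (phi t) -> 0 < phi^`() t ->
  f^`() t = phi^`() t *: a^`() (phi t) ->
  f^`(2) t = phi^`(2) t *: a^`() (phi t) + phi^`() t ^+ 2 *: a^`(2) (phi t) ->
  osc_curve f t = frame_mx (phi t).
Proof.
move=> Ip fE phi0 f'E f2E; have W0 := W_gt0 Ip.
have w1 : wedge (f t) (f^`() t) = phi^`() t * wedge (a (phi t)) (a^`() (phi t)).
  by rewrite fE f'E wedgeZr.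
have w2 : wedge (f^`() t) (f^`(2) t) =
    phi^`() t ^+ 3 * wedge (a (phi t)) (a^`() (phi t)).
  by rewrite f'E f2E wedge_reparam12 (centro_frame_wedge12 Ip).
rewrite osc_curveE ?w1 ?w2 ?mulr_gt0 ?exprn_gt0 //.
apply/matrixP => i j; rewrite osc_mxE w1 w2 frame_mxE fE f'E !mxE.
move: (phi^`() t) phi0 (wedge _ _) W0 => r r0 w w0.
by field; rewrite !gt_eqF.
Qed.

Lemma det_frame_mx u : \det (frame_mx u) = wedge (a u) (a^`() u) ^+ 2.
Proof. by rewrite det2E !frame_mxE wedgeE; ring. Qed.

Lemma posdef_frame_mx u : I u -> posdef_mx (frame_mx u).
Proof.
move=> Iu; have W0 := W_gt0 Iu.
have -> : frame_mx u = osc_mx (a u) (a^`() u) (- a u).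
  rewrite /osc_mx (_ : wedge _ (- _) = wedge (a u) (a^`() u)); last first.
    by rewrite !wedgeE !mxE; ring.
  by rewrite divff ?scale1r // gt_eqF.
apply: posdef_osc_mx => //; rewrite (_ : wedge _ _ = wedge (a u) (a^`() u)) //.
by rewrite !wedgeE !mxE; ring.
Qed.

(** In the standard parameter, the curve of osculating ellipses has velocity
    [k a' a'^T]: the other terms cancel by the defining equation. *)
Lemma is_derive_frame_mx u i j : I u ->
  is_derive u 1 (fun u => frame_mx u i j)
    (k u * (a^`() u i 0 * a^`() u j 0)).
Proof.
move=> Iu.
have d l := is_derive_mx_entry l 0 (der_a Iu).
have d' l := is_derive_mx_entry l 0 (der_a' Iu).
have H := is_deriveD (is_deriveM (d i) (d j)) (is_deriveM (d' i) (d' j)).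
rewrite (_ : (fun u => _) = (fun u => a u i 0) * (fun u => a u j 0)
  + (fun u => a^`() u i 0) * (fun u => a^`() u j 0)); last first.
  by apply/funext => s; rewrite frame_mxE.
apply: (is_derive_eq H); rewrite -[a^`()^`()]/(a^`(2)) (ode Iu) !mxE.
rewrite /GRing.scale /=.
move: (a u i 0) (a u j 0) (a^`() u i 0) (a^`() u j 0) (k u) => *; by field.
Qed.

(** The curve of osculating ellipses has velocity [phi' k w w^T], of rank 1,
    where [w] is the tangent vector [a'] of the standard parametrization. The
    second derivative has determinant [- (phi' k (w /\ w'))^2]; this gives the
    norm of the acceleration. *)
Lemma osc_curve_along (J : set R) (f : R -> 'cV[R]_2) (phi : R -> R) :
  open J -> Ck 3 J phi ->
  (forall t, J t ->
    [/\ I (phi t), f t = a (phi t), 0 < phi^`() t,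
        f^`() t = phi^`() t *: a^`() (phi t)
      & f^`(2) t = phi^`(2) t *: a^`() (phi t)
                   + phi^`() t ^+ 2 *: a^`(2) (phi t)]) ->
  [/\ smooth_on J (osc_curve f),
      forall t, J t -> velocity_sqnorm (osc_curve f) t = 0
    & forall t, J t -> acceleration_sqnorm (osc_curve f) t =
                       phi^`() t ^+ 4 * k (phi t) ^+ 2].
Proof.
move=> oJ Ck_phi H.
have IJ t : J t -> I (phi t) by move=> /H[].
have oscE t : J t -> osc_curve f t = frame_mx (phi t).
  by move=> /H[]; exact: osc_curve_factor.
have dphi t : J t -> is_derive t 1 phi (phi^`() t).
  move=> Jt; rewrite derive1E; apply: derivableP.
  exact: (@Ck_derivable _ _ 2 _ _ _ oJ Ck_phi Jt).
pose g t := phi^`() t * k (phi t).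
pose v t := phi^`() t *: a^`(2) (phi t).
pose N t : 'M[R]_2 := g t *: (a^`() (phi t) *m (a^`() (phi t))^T).
have NE t i j : N t i j = g t * (a^`() (phi t) i 0 * a^`() (phi t) j 0).
  by rewrite mxE outerE.
have dosc t : J t -> (osc_curve f)^`() t = N t.
  move=> Jt.
  have [|_ <-] := @is_derive_derive1_eq R 2 2 (fun s => frame_mx (phi s)) t (N t).
    move=> i j; have dF := is_derive_frame_mx i j (IJ t Jt).
    apply: (is_derive_eq (is_derive1_comp dF (dphi t Jt))).
    by rewrite NE mulrC mulrA.
  rewrite !derive1E; apply: near_eq_derive.
  by apply: filterS (open_near oJ Jt) => s /oscE.
pose N' t : 'M[R]_2 := \matrix_(i, j)
  (g t * (a^`() (phi t) i 0 * v t j 0 + a^`() (phi t) j 0 * v t i 0)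
   + a^`() (phi t) i 0 * a^`() (phi t) j 0 * g^`() t).
have N'E t i j : N' t i j =
    g t * (a^`() (phi t) i 0 * v t j 0 + a^`() (phi t) j 0 * v t i 0)
    + a^`() (phi t) i 0 * a^`() (phi t) j 0 * g^`() t by rewrite mxE.
have dosc2 t : J t -> (osc_curve f)^`()^`() t = N' t.
  move=> Jt.
  have dg : is_derive t 1 g (g^`() t).
    rewrite derive1E; apply: derivableP; apply: (@Ck_derivable _ _ 1 J) => //.
    apply: CkM => //; first exact: (Ck_derive1 oJ Ck_phi).
    exact: (CkW (Ck_comp oJ oI IJ Ck_k Ck_phi)).
  have dphit : derivable phi t 1 by have [] := dphi t Jt.
  have [dw wE] := is_derive_curve_comp dphit (der_a' (IJ t Jt)).
  have dwi i := is_derive_mx_entry i 0 dw; rewrite wE in dwi.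
  have [|_ <-] := @is_derive_derive1_eq R 2 2 N t (N' t).
    move=> i j; have HN := is_deriveM dg (is_deriveM (dwi i) (dwi j)).
    rewrite (_ : (fun s => N s i j) = g * ((fun s => (a^`() \o phi) s i 0)
        * (fun s => (a^`() \o phi) s j 0))); last first.
      by apply/funext => s; rewrite NE.
    by apply: (is_derive_eq HN); rewrite N'E.
  rewrite !derive1E; apply: near_eq_derive.
  by apply: filterS (open_near oJ Jt) => s /dosc.
have detN t : \det (N t) = 0 by rewrite det2E !NE; ring.
split.
- apply: (@Ck_eq _ _ _ _ _ (fun t => frame_mx (phi t)) _ oJ).
    by move=> t Jt; rewrite oscE.
  apply/(Ck_mxP _ _ oJ) => i j.
  have ci l : Ck 3 J (fun t => a (phi t) l 0).
    exact: (Ck_comp oJ oI IJ ((Ck_mxP _ _ oI).1 Ck_a l 0) Ck_phi).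
  have ci' l : Ck 3 J (fun t => a^`() (phi t) l 0).
    exact: (Ck_comp oJ oI IJ ((Ck_mxP _ _ oI).1 Ck_a' l 0) Ck_phi).
  have := CkD oJ (CkM oJ (ci i) (ci j)) (CkM oJ (ci' i) (ci' j)).
  by apply: (Ck_eq oJ) => t _; rewrite frame_mxE.
- move=> t Jt; rewrite /velocity_sqnorm sqnormE (dosc _ Jt) detN.
  by rewrite mul0r oppr0.
- move=> t Jt; rewrite /acceleration_sqnorm /cov_derivative (dosc2 _ Jt).
  rewrite (dosc _ Jt) (oscE _ Jt) sqnorm_null_acceleration //.
  + have W0 : wedge (a (phi t)) (a^`() (phi t)) != 0.
      by rewrite gt_eqF //; exact: W_gt0 (IJ _ Jt).
    have -> : \det (N' t) = - (g t * wedge (a^`() (phi t)) (v t)) ^+ 2.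
      rewrite det2E !N'E wedgeE; move: (v t) (a^`() (phi t)) (g t) (g^`() t).
      by move=> v0 w0 g0 g1; ring.
    rewrite det_frame_mx /v wedgeZr (centro_frame_wedge12 (IJ _ Jt)) /g.
    move: (wedge _ _) W0 (phi^`() t) (k _) => w W0 p kk.
    by field.
  + exact: posdef_frame_mx (IJ _ Jt).
  + by apply/sym_mxP; rewrite !NE mulrC; ring.
  + rewrite /polar_det !NE !N'E; move: (v t) (a^`() (phi t)) (g t) (g^`() t).
    by move=> v0 w0 g0 g1; ring.
Qed.

End CentroFrame.

(** If a path has a frame, then all its standard centro-affine parametrizations
    have the same velocity and the same curvature at a given point as this
    frame. *)
Lemma std_centro_affine_uniq (R : realType) (c : oriented_set R)
    (I J : set R) (a f : R -> 'cV[R]_2) (k l : R -> R) t :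
  is_orientation c -> centro_frame c I a k -> std_centro_affine c J f l -> J t ->
  exists2 u, I u & [/\ f t = a u, f^`() t = a^`() u & l t = k u].
Proof.
move=> oc fr sf Jt; have pf : parametrization c J f by case: sf.
have oJ : open J by case: pf => -[].
have [phi [Ck_phi H]] := parametrization_frame_factor oc fr pf.
have ff : centro_frame c J f l.
  by split=> // s Js; have [] := parametrization_convex oc fr pf Js.
(* As [a' /\ a''] equals [a /\ a'] in both parameters, [phi' ^ 3 = phi']. *)
have phi1 s : J s -> phi^`() s = 1.
  move=> Js; have [Ip fE p0 f'E f2E] := H s Js.
  have W0 := fr.2 _ Ip.
  have := centro_frame_wedge12 ff Js; rewrite f2E f'E fE.
  rewrite wedge_reparam12 wedgeZr (centro_frame_wedge12 fr Ip).
  move=> /(mulIf (negbT (gt_eqF W0))).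
  rewrite exprSr -[RHS]mul1r => /(mulIf (negbT (gt_eqF p0))) /eqP.
  by rewrite sqrf_eq1 => /orP[/eqP //|/eqP E]; move: p0; rewrite E; lra.
have phi2 : phi^`(2) t = 0.
  rewrite derive1nS derive1n1 -[RHS](derive1_cst (1 : R) t) !derive1E.
  by apply: near_eq_derive; apply: filterS (open_near oJ Jt) => s /phi1.
have [Ip fE p0 f'E f2E] := H t Jt; have W0 := fr.2 _ Ip.
rewrite (phi1 _ Jt) scale1r in f'E.
rewrite phi2 (phi1 _ Jt) scale0r add0r expr1n scale1r in f2E.
exists (phi t); first exact: Ip.
split; [exact: fE|exact: f'E|].
have := centro_frame_wedge02 ff Jt; rewrite f2E f'E fE.
rewrite (centro_frame_wedge02 fr Ip) => /(mulIf (negbT (gt_eqF W0))).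
by move: (k _) (l t) => x y; lra.
Qed.

(** The centro-affine curvature of a path can be computed in any frame. *)
Lemma centro_affine_curvatureE (R : realType) (c : oriented_set R)
    (I : set R) (a : R -> 'cV[R]_2) (k : R -> R) u :
  is_orientation c -> centro_frame c I a k -> I u ->
  centro_affine_curvature c (a u) = k u.
Proof.
move=> oc fr Iu; rewrite /centro_affine_curvature.
set P := [set r | _].
have : P (get P) by apply: getI; exists I, a, k, u; split=> //; case: fr.
move: (get P) => r [J [f [l [t [sf Jt fa <-]]]]].
have [v Iv [fv _ ->]] := std_centro_affine_uniq oc fr sf Jt.
have ea : embedding I a by case: fr => -[[]].
by rewrite (embedding_inj ea Iv Iu) // -fv.
Qed.

(** Convexity of one parametrization gives the positivity of the areas
    [wedge (a u) (a' u)] for the standard ones. *)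
Lemma curved_path_frame (R : realType) (c : oriented_set R) : curved_path c ->
  is_orientation c /\ exists (I : set R) (a : R -> 'cV[R]_2) (k : R -> R),
    centro_frame c I a k /\ forall u, I u -> k u != 0.
Proof.
move=> [[[_ _ oc] [J [f [pf cf]]]] [I [a [k sa]]] kn0]; split=> //.
have pa : parametrization c I a by case: sa.
have [_ ea aI _] := pa.
have fr : centro_frame c I a k.
  split=> // u Iu; have [phi H] := parametrization_factor oc pa pf.
  have [_ _ fJ _] := pf.
  have [t Jt ft] : (f @` J) (a u) by rewrite fJ -aI; exists u.
  have [Ip fE _ p0 f'E] := H t Jt; have [cf0 _] := cf t Jt.
  have <- : phi t = u by apply: (embedding_inj ea Ip Iu); rewrite -fE.
  by move: cf0; rewrite f'E fE wedgeZr (pmulr_rgt0 _ p0).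
exists I, a, k; split=> // u Iu.
rewrite -(centro_affine_curvatureE oc fr Iu); apply: kn0.
by rewrite -aI; exists u.
Qed.

(** * The action of linear maps of positive determinant *)

Lemma cvg_within_comp (S T U : topologicalType) (A : set T) (B : set S)
    (L : S -> T) (f : T -> U) (x : S) :
  L @ x --> L x -> (forall y, B y -> A (L y)) ->
  f @ within A (nbhs (L x)) --> f (L x) ->
  (f \o L) @ within B (nbhs x) --> f (L x).
Proof.
move=> cL BA cf; apply: cvg_comp cf => P; rewrite !nbhs_simpl /= => wP.
have := cL _ wP; rewrite nbhs_simpl /=.
by apply: filterS => y H By; apply: H; exact: BA.
Qed.

Lemma within_continuous_comp (S T U : topologicalType) (A : set T) (B : set S)
    (L : S -> T) (f : T -> U) :
  continuous L -> (forall y, B y -> A (L y)) -> {within A, continuous f} ->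
  {within B, continuous (f \o L)}.
Proof.
move=> cL BA /subspace_continuousP cf; apply/subspace_continuousP => x Bx.
by apply: (cvg_within_comp (cL x) BA); exact/cf/BA.
Qed.

Lemma continuous_within_comp (T U W : topologicalType) (A : set T)
    (L : U -> W) (f : T -> U) :
  continuous L -> {within A, continuous f} -> {within A, continuous (L \o f)}.
Proof.
move=> cL /subspace_continuousP cf; apply/subspace_continuousP => x Ax.
by apply: cvg_comp (cf x Ax) _; exact: cL.
Qed.

Lemma mulmx2_continuous (R : realType) (g : 'M[R]_2) :
  continuous (mulmx g : 'cV[R]_2 -> 'cV[R]_2).
Proof.
have E : (mulmx g : 'cV[R]_2 -> 'cV[R]_2) =
    fun v => v 0 0 *: col 0 g + v 1 0 *: col 1 g.
  apply/funext => v; apply/matrixP => i j.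
  by rewrite ord1 !mxE sum2E mulrC [X in _ + X]mulrC.
rewrite E => v.
have cc i : (fun u : 'cV[R]_2 => u i 0 : R) @ v --> v i 0.
  exact: coord_continuous.
exact: (cvgD (cvgZ (cc 0) (cvg_cst (col 0 g))) (cvgZ (cc 1) (cvg_cst (col 1 g)))).
Qed.

Section LinearAction.
Context {R : realType} (g : 'M[R]_2).

Lemma Ck_mulmx (V : normedModType R) k (U : set V) (f : V -> 'cV[R]_2) :
  open U -> Ck k U f -> Ck k U (fun x => g *m f x).
Proof. by move=> oU; apply: Ck_linear_comp => //; exact: mulmx2_continuous. Qed.

Lemma derive1_mulmx (f : R -> 'cV[R]_2) t : derivable f t 1 ->
  (fun s => g *m f s)^`() t = g *m f^`() t.
Proof.
move=> df; have [|_ //] := @is_derive_derive1_eq R 2 1 (fun s => g *m f s) t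
  (g *m f^`() t).
move=> i j; rewrite ord1.
have d l := is_derive_mx_entry l 0 df.
have H := is_deriveD (is_deriveZ (g i 0) (d 0)) (is_deriveZ (g i 1) (d 1)).
rewrite (_ : (fun s => _) = g i 0 \*: (fun s => f s 0 0)
    + g i 1 \*: (fun s => f s 1 0)); last first.
  by apply/funext => s; rewrite mxE sum2E.
by apply: (is_derive_eq H); rewrite mxE sum2E.
Qed.

Lemma derive2_mulmx (I : set R) (f : R -> 'cV[R]_2) t : open I -> Ck 3 I f ->
  I t -> (fun s => g *m f s)^`(2) t = g *m f^`(2) t.
Proof.
move=> oI fk It; rewrite [in LHS]derive1nS derive1n1 [in RHS]derive1nS derive1n1.
have f'k : Ck 2 I f^`() := Ck_derive1 oI fk.
rewrite -(derive1_mulmx (@Ck_derivable _ _ 1 _ _ _ oI f'k It)).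
rewrite [LHS]derive1E [RHS]derive1E; apply: near_eq_derive.
apply: filterS (open_near oI It) => s Is.
exact: derive1_mulmx (@Ck_derivable _ _ 2 _ _ _ oI fk Is).
Qed.

Hypothesis g_gt0 : 0 < \det g.

Let gu : g \in unitmx.
Proof. by rewrite unitmxE unitfE gt_eqF. Qed.

Let mulKg (v : 'cV[R]_2) : invmx g *m (g *m v) = v.
Proof. by rewrite mulKmx. Qed.

Let mulVKg (v : 'cV[R]_2) : g *m (invmx g *m v) = v.
Proof. by rewrite mulKVmx. Qed.

Let mulg_neq0 (v : 'cV[R]_2) : v != 0 -> g *m v != 0.
Proof. by apply: contra => /eqP gv; rewrite -(mulKg v) gv mulmx0. Qed.

Variable c : oriented_set R.

Lemma tangent_mulmx p v : tangent c p v -> tangent (path_image g c) (g *m p) (g *m v).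
Proof.
move=> [J [a [[[oJ iJ] J0] ak aJ a0 a'0]]].
exists J, (fun t => g *m a t); split.
- by [].
- exact: (Ck_mulmx oJ ak).
- by move=> _ [t Jt <-] /=; exists (a t) => //; apply: aJ; exists t.
- by rewrite a0.
- by rewrite (derive1_mulmx (@Ck_derivable _ _ 2 _ _ _ oJ ak J0)) a'0.
Qed.

Lemma parametrization_mulmx (I : set R) (a : R -> 'cV[R]_2) :
  parametrization c I a -> parametrization (path_image g c) I (fun t => g *m a t).
Proof.
move=> [[oI iI] [ak a'0 [b [ba cb]]] aI pa].
have da t : I t -> derivable a t 1.
  by move=> It; exact: (@Ck_derivable _ _ 2 _ _ _ oI ak It).
split; first by [].
- split.
  + exact: (Ck_mulmx oI ak).
  + move=> t It; rewrite (derive1_mulmx (da t It)).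
    by apply: mulg_neq0; exact: a'0.
  + exists (b \o mulmx (invmx g)); split.
      by move=> t It /=; rewrite mulKg ba.
    apply: within_continuous_comp cb; first exact: mulmx2_continuous.
    by move=> _ [t It <-]; rewrite mulKg; exists t.
- rewrite /= -aI; apply/seteqP; split=> [_ [t It <-]|_ [_ [t It <-] <-]].
    by exists (a t) => //; exists t.
  by exists t.
- move=> t It /=; rewrite mulKg (derive1_mulmx (da t It)).
  by exists (a^`() t) => //; exact: pa.
Qed.

Lemma std_centro_affine_mulmx (I : set R) (a : R -> 'cV[R]_2) (k : R -> R) :
  std_centro_affine c I a k ->
  std_centro_affine (path_image g c) I (fun t => g *m a t) k.
Proof.
move=> [pa kk ode]; split; [exact: parametrization_mulmx|exact: kk|].
have [[oI _] [ak _ _] _ _] := pa; move=> t It.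
rewrite (derive2_mulmx oI ak It) (ode _ It).
rewrite (derive1_mulmx (@Ck_derivable _ _ 2 _ _ _ oI ak It)).
by rewrite mulmxDr mulmxN scalemxAr.
Qed.

Lemma centro_frame_mulmx (I : set R) (a : R -> 'cV[R]_2) (k : R -> R) :
  centro_frame c I a k ->
  centro_frame (path_image g c) I (fun t => g *m a t) k.
Proof.
move=> [sa W0]; split; first exact: std_centro_affine_mulmx.
move=> t It; have [[[oI _] [ak _ _] _ _] _ _] := sa.
rewrite (derive1_mulmx (@Ck_derivable _ _ 2 _ _ _ oI ak It)) wedge_mulmx.
by apply: mulr_gt0 => //; exact: W0.
Qed.

Lemma is_orientation_mulmx : is_orientation c -> is_orientation (path_image g c).
Proof.
move=> oc _ [p cp <-]; have [U [w [oU Up cw H]]] := oc p cp.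
have cg := @mulmx2_continuous R g; have cgi := @mulmx2_continuous R (invmx g).
exists (mulmx (invmx g) @^-1` U), (fun q => g *m w (invmx g *m q)); split.
- by apply: open_comp => // x _; exact: cgi.
- by rewrite /preimage /= mulKg.
- apply: (@continuous_within_comp _ _ _ _ (mulmx g) (w \o mulmx (invmx g))) => //.
  apply: within_continuous_comp cw => //.
  by move=> y [[q cq <-]]; rewrite /preimage /= mulKg.
move=> _ [q cq <-]; rewrite /preimage /= mulKg => Uq.
have [tw w0 pE] := H q cq Uq; split.
- exact: tangent_mulmx.
- exact: mulg_neq0.
- rewrite pE; apply/seteqP; split=> [_ [_ [s s0 <-] <-]|_ [s s0 <-]].
    by exists s => //; rewrite scalemxAr.
  by exists (s *: w q); [exists s|rewrite scalemxAr].
Qed.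

Lemma submanifold1_mulmx : submanifold1 c -> submanifold1 (path_image g c).
Proof.
move=> sc _ [p cp <-]; have [U [V [f [h [[oU oV Up] [fk hk] fU hf fc]]]]] := sc p cp.
have cgi := @mulmx2_continuous R (invmx g).
exists (mulmx (invmx g) @^-1` U), V, (f \o mulmx (invmx g)), (fun y => g *m h y).
split.
- split=> //; last by rewrite /preimage /= mulKg.
  by apply: open_comp => // x _; exact: cgi.
- split; last exact: (Ck_mulmx oV hk).
  exact: (Ck_comp_linear oU cgi fk).
- rewrite -fU; apply/seteqP; split=> [_ [q Uq <-]|_ [q Uq <-]].
    by exists (invmx g *m q).
  by exists (g *m q); rewrite /preimage /= mulKg.
- by move=> q Uq /=; rewrite hf // mulVKg.
- rewrite -fc; apply/seteqP; split=> [_ [_ [[q cq <-] Uq] <-]|_ [q [cq Uq] <-]].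
    by move: Uq; rewrite /preimage /= mulKg => Uq; exists q.
  exists (g *m q); last by rewrite /= mulKg.
  by split; [exists q|rewrite /preimage /= mulKg].
Qed.

Lemma diffeomorphic_to_line_mulmx :
  diffeomorphic_to_line c -> diffeomorphic_to_line (path_image g c).
Proof.
move=> [a [b [ak aI bs ba]]].
exists (fun t => g *m a t), (b \o mulmx (invmx g)); split.
- exact: (Ck_mulmx openT ak).
- rewrite /= -aI; apply/seteqP; split=> [_ [t _ <-]|_ [_ [t _ <-] <-]].
    by exists (a t) => //; exists t.
  by exists t.
- move=> _ [p cp <-]; have [U [B [oU Up Bk BE]]] := bs p cp.
  have cgi := @mulmx2_continuous R (invmx g).
  exists (mulmx (invmx g) @^-1` U), (B \o mulmx (invmx g)); split.
  + by apply: open_comp => // x _; exact: cgi.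
  + by rewrite /preimage /= mulKg.
  + exact: (Ck_comp_linear oU cgi Bk).
  + by move=> _ [q cq <-]; rewrite /preimage /= mulKg => Uq; exact: BE.
- by move=> t /=; rewrite mulKg.
Qed.

Lemma curved_path_mulmx : curved_path c -> curved_path (path_image g c).
Proof.
move=> cc; have [oc [I [a [k [fr k0]]]]] := curved_path_frame cc.
have [[[sc dc _] _] _ _] := cc.
have ogc := is_orientation_mulmx oc.
have gfr := centro_frame_mulmx fr.
have gpar : parametrization (path_image g c) I (fun t => g *m a t).
  by case: gfr => -[].
split.
- split; first by split; [exact: submanifold1_mulmx
    |exact: diffeomorphic_to_line_mulmx|].
  exists I, (fun t => g *m a t); split=> //.
  exact: parametrization_convex ogc gfr _ _ gpar.
- by exists I, (fun t => g *m a t), k; case: gfr.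
- move=> _ [p cp <-]; have [[_ _ aI _] _ _] := fr.1.
  have [u Iu <-] : (a @` I) p by rewrite aI.
  by rewrite (centro_affine_curvatureE ogc gfr Iu); exact: k0.
Qed.

End LinearAction.

(** * The invariant 1-form *)

(** The velocity at the point [p] of the standard centro-affine
    parametrizations of [c]. *)
Definition centro_velocity (R : realType) (c : oriented_set R)
    (p : 'cV[R]_2) : 'cV[R]_2 :=
  get [set w | exists (I : set R) (a : R -> 'cV[R]_2) (k : R -> R) (t : R),
         [/\ std_centro_affine c I a k, I t, a t = p & a^`() t = w]].

Lemma centro_velocityE (R : realType) (c : oriented_set R)
    (I : set R) (a : R -> 'cV[R]_2) (k : R -> R) u :
  is_orientation c -> centro_frame c I a k -> I u ->
  centro_velocity c (a u) = a^`() u.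
Proof.
move=> oc fr Iu; rewrite /centro_velocity.
set P := [set w | _].
have : P (get P).
  by apply: getI; exists I, a, k, u; split; [exact: fr.1|exact: Iu|by []|by []].
move: (get P) => w [J [f [l [t [sf Jt fa <-]]]]].
have [v Iv [fv -> _]] := std_centro_affine_uniq oc fr sf Jt.
have ea : embedding I a by case: fr => -[[]].
by rewrite (embedding_inj ea Iv Iu) // -fv.
Qed.

(** The 1-form equal to the square root of the absolute value of the
    centro-affine curvature, times the differential of the standard
    centro-affine parameter. *)
Definition ellipse_arc_form (R : realType) (c : oriented_set R)
    (p v : 'cV[R]_2) : R :=
  Num.sqrt `|centro_affine_curvature c p|
    * (wedge p v / wedge p (centro_velocity c p)).

Lemma cvg_wedge (R : realType) (T : Type) (F : set_system T) {FF : Filter F}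
    (f g : T -> 'cV[R]_2) (u v : 'cV[R]_2) :
  f @ F --> u -> g @ F --> v -> (fun x => wedge (f x) (g x)) @ F --> wedge u v.
Proof.
move=> fu gv.
have cc (h : T -> 'cV[R]_2) (w : 'cV[R]_2) i : h @ F --> w ->
    (fun x => h x i 0 : R) @ F --> w i 0.
  move=> hw; have cw := @coord_continuous R 2 1 i 0 w.
  exact: (@cvg_comp _ _ _ h (fun M : 'cV[R]_2 => M i 0 : R) _ _ _ hw cw).
rewrite (_ : (fun x => _) = fun x => f x 0 0 * g x 1 0 - g x 0 0 * f x 1 0); last first.
  by apply/funext => x; rewrite wedgeE.
rewrite wedgeE; apply: cvgB; apply: cvgM; exact: cc.
Qed.

Lemma tangent_base (R : realType) (c : set 'cV[R]_2) p v : tangent c p v -> c p.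
Proof. by move=> [J [a [[_ J0] _ aJ <- _]]]; apply: aJ; exists 0. Qed.

Lemma tangent_parametrization (R : realType) (c : oriented_set R) (I : set R)
    (a : R -> 'cV[R]_2) t :
  parametrization c I a -> I t -> tangent c (a t) (a^`() t).
Proof.
move=> [[oI iI] [ak _ _] aI _] It.
(* Tangent vectors are velocities at the parameter 0: shift the parameter. *)
pose L : R -> R := fun s => s + t.
have cL : continuous L by move=> s; apply: cvgD; [exact: cvg_id|exact: cvg_cst].
have oJ : open (L @^-1` I) by apply: open_comp => // x _; exact: cL.
have LC : Ck 3 (L @^-1` I) L.
  apply: CkD => //; last exact: Ck_cst.
  have id1 : (id : R -> R)^`() = cst 1.
    by apply/funext => s; rewrite derive1E derive_id.
  apply/(CkS_derive1 _ _ oJ); split; first by move=> s _; exact: derivable_id.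
  by rewrite id1; exact: Ck_cst.
have L0 : L 0 = t by rewrite /L add0r.
exists (L @^-1` I), (a \o L); split.
- split; last by rewrite /preimage /= L0.
  split=> // x y; rewrite /preimage /= => Ix Iy z /andP[xz zy].
  by apply: (iI _ _ Ix Iy); rewrite /L !lerD2r xz zy.
- apply/(Ck_mxP _ _ oJ) => i j.
  exact: (Ck_comp oJ oI (fun s Js => Js) ((Ck_mxP _ _ oI).1 ak i j) LC).
- by move=> _ [s Ls <-]; rewrite -aI; exists (L s).
- by rewrite /= L0.
- have dL : derivable L 0 1.
    by apply: (@Ck_derivable _ _ 2 _ _ _ oJ LC); rewrite /preimage /= L0.
  have da : derivable a (L 0) 1.
    by rewrite L0; exact: (@Ck_derivable _ _ 2 _ _ _ oI ak It).
  have [_ ->] := is_derive_curve_comp dL da.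
  rewrite L0 (_ : L^`() 0 = 1) ?scale1r //.
  by rewrite derive1E; have [_] := @is_derive_shift R 0 1 t.
Qed.

Section ArcForm.
Context {R : realType} (c : oriented_set R) (I : set R) (a : R -> 'cV[R]_2)
  (k : R -> R).
Hypotheses (oc : is_orientation c) (fr : centro_frame c I a k).

Let par : parametrization c I a. Proof. by case: fr => -[]. Qed.
Let oI : open I. Proof. by case: par => -[]. Qed.
Let ea : embedding I a. Proof. by case: par. Qed.
Let aI : a @` I = c. Proof. by case: par. Qed.

Lemma ellipse_arc_formE u s : I u ->
  ellipse_arc_form c (a u) (s *: a^`() u) = s * Num.sqrt `|k u|.
Proof.
move=> Iu; rewrite /ellipse_arc_form (centro_velocityE oc fr Iu).
rewrite (centro_affine_curvatureE oc fr Iu) wedgeZr mulrC mulfK //.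
by rewrite gt_eqF // fr.2.
Qed.

Lemma tangent_frame p v : tangent c p v ->
  exists u s, [/\ I u, p = a u & v = s *: a^`() u].
Proof.
move=> tv; have cp := tangent_base tv; rewrite -aI in cp tv.
have [u Iu au] := cp; rewrite -au in tv.
by have [s vE] := tangent_embedding oI ea Iu tv; exists u, s.
Qed.

Lemma ellipse_arc_form_one_form : is_one_form c (ellipse_arc_form c).
Proof.
split.
  move=> p _ r v w _ _; rewrite /ellipse_arc_form wedgeDr wedgeZr; ring.
have [b [ba cb]] : exists b : 'cV[R]_2 -> R,
    (forall t, I t -> b (a t) = t) /\ {within c, continuous b}.
  by rewrite -aI; case: ea.
apply/subspace_continuousP => -[p v] /= tv.
set T := [set x | _].
have cp := tangent_base tv; have [u Iu au] : (a @` I) p by rewrite aI.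
have bp : b p = u by rewrite -au ba.
have cbT : (b \o fst) @ within T (nbhs (p, v)) --> u.
  rewrite -bp; apply: (@cvg_within_comp _ _ _ c T fst b (p, v)).
  - exact: cvg_fst.
  - by move=> x /tangent_base.
  - exact: ((subspace_continuousP _ _).1 cb _ cp).
have ck : {for u, continuous k}.
  have Ck_k : Ck 3 I k by case: fr => -[].
  apply: differentiable_continuous; apply/derivable1_diffP.
  exact: (@Ck_derivable _ _ 2 _ _ _ oI Ck_k Iu).
have ca' : {for u, continuous a^`()}.
  have Ck_a : Ck 3 I a by case: ea.
  apply: differentiable_continuous; apply/derivable1_diffP.
  exact: (@Ck_derivable _ _ 1 _ _ _ oI (Ck_derive1 oI Ck_a) Iu).
have W0 : wedge p (a^`() u) != 0 by rewrite -au gt_eqF // fr.2.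
(* On tangent vectors the form is given by an expression [F] in the inverse [b]
   of the parametrization, which is continuous on the path. *)
pose F (x : 'cV[R]_2 * 'cV[R]_2) := Num.sqrt `|k (b x.1)|
  * (wedge x.1 x.2 / wedge x.1 (a^`() (b x.1))).
have FE x : T x -> ellipse_arc_form c x.1 x.2 = F x.
  move=> Tx; have cx := tangent_base Tx; have [w Iw aw] : (a @` I) x.1 by rewrite aI.
  rewrite /ellipse_arc_form /F -aw ba // (centro_velocityE oc fr Iw).
  by rewrite (centro_affine_curvatureE oc fr Iw).
suff H : (fun x => ellipse_arc_form c x.1 x.2) @ within T (nbhs (p, v))
    --> F (p, v).
  by rewrite -(FE (p, v) tv) in H; exact: H.
have nearF : \forall x \near within T (nbhs (p, v)), F x = ellipse_arc_form c x.1 x.2.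
  by apply: filterS (withinT _ _) => x /FE.
apply: cvg_trans (near_eq_cvg nearF) _.
have c1 : fst @ within T (nbhs (p, v)) --> p.
  by apply: cvg_within_filter; exact: cvg_fst.
have c2 : snd @ within T (nbhs (p, v)) --> v.
  by apply: cvg_within_filter; exact: cvg_snd.
rewrite /F /= bp; apply: cvgM.
  have ckT : (fun x => k (b x.1)) @ within T (nbhs (p, v)) --> k u.
    exact: cvg_comp cbT ck.
  by apply: cvg_comp (cvg_norm ckT) _; exact: sqrt_continuous.
apply: cvgM; first exact: cvg_wedge c1 c2.
apply: cvgV => //; apply: cvg_wedge c1 _.
exact: cvg_comp cbT ca'.
Qed.

Lemma ellipse_arc_form_arc_element (J : set R) (f : R -> 'cV[R]_2) :
  parametrization c J f -> arc_element J f (ellipse_arc_form c).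
Proof.
move=> pf t Jt; have [phi [Ck_phi H]] := parametrization_frame_factor oc fr pf.
have oJ : open J by case: pf => -[].
have [_ _ ->] := osc_curve_along fr oJ Ck_phi H; last by [].
have [Ip -> p0 -> _] := H t Jt; rewrite ellipse_arc_formE //.
move: (phi^`() t) p0 (k _) => r r0 l.
have y0 : 0 <= r * Num.sqrt `|l| by rewrite mulr_ge0 ?sqrtr_ge0 // ltW.
have -> : r ^+ 4 * l ^+ 2 = (r * Num.sqrt `|l|) `^ 4.
  rewrite -[4%R]/(4%:R) powR_mulrn // exprMn; congr (_ * _).
  by rewrite -[4%N]/(2 * 2)%N exprM sqr_sqrtr // real_normK // num_real.
by rewrite -powRrM divff ?powRr1 // pnatr_eq0.
Qed.

End ArcForm.

(** A 1-form is determined by its values on the velocity of one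
    parametrization, which spans the tangent lines. *)
Lemma arc_element_uniq (R : realType) (c : oriented_set R) (I : set R)
    (a : R -> 'cV[R]_2) (tau tau' : 'cV[R]_2 -> 'cV[R]_2 -> R) :
  parametrization c I a -> is_one_form c tau -> is_one_form c tau' ->
  arc_element I a tau -> arc_element I a tau' -> eq_one_form c tau tau'.
Proof.
move=> pa [lin _] [lin' _] at1 at2 p v cp tv.
have [[oI _] ea aI _] := pa.
have [u Iu au] : (a @` I) p by rewrite aI.
have ta := tangent_parametrization pa Iu.
have [s ->] : exists s, v = s *: a^`() u.
  by apply: (tangent_embedding oI ea Iu); rewrite aI au.
have scal (th : 'cV[R]_2 -> 'cV[R]_2 -> R) :
    (forall r v w, tangent c p v -> tangent c p w ->
       th p (r *: v + w) = r * th p v + th p w) ->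
    th p (s *: a^`() u) = s * th p (a^`() u).
  rewrite -au => L; rewrite -[s](subrK 1) scalerDl scale1r L //.
  ring.
rewrite (scal tau (lin p cp)) (scal tau' (lin' p cp)) -au.
by rewrite (at1 _ Iu) (at2 _ Iu).
Qed.

Theorem theorem6 (R : realType) :
  (forall (c : oriented_set R) (I : set R) (a : R -> 'cV[R]_2),
     curved_path c -> parametrization c I a ->
     [/\ smooth_on I (osc_curve a),
         forall t, I t -> velocity_sqnorm (osc_curve a) t = 0
       & forall t, I t -> 0 < acceleration_sqnorm (osc_curve a) t]) /\
  exists tau : oriented_set R -> 'cV[R]_2 -> 'cV[R]_2 -> R,
    (forall c : oriented_set R, curved_path c ->
       [/\ is_one_form c (tau c),
           forall (I : set R) (a : R -> 'cV[R]_2),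
             parametrization c I a -> arc_element I a (tau c)
         & forall (I : set R) (a : R -> 'cV[R]_2)
                  (tau' : 'cV[R]_2 -> 'cV[R]_2 -> R),
             parametrization c I a -> is_one_form c tau' ->
             arc_element I a tau' -> eq_one_form c tau' (tau c)]) /\
    (forall (g : 'M[R]_2) (c : oriented_set R), 0 < \det g -> curved_path c ->
       curved_path (path_image g c) /\
       eq_one_form c (tau c) (pullback_linear g (tau (path_image g c)))).
Proof.
split=> [c J f cc pf|].
  have [oc [I [a [k [fr k0]]]]] := curved_path_frame cc.
  have [phi [Ck_phi H]] := parametrization_frame_factor oc fr pf.
  have oJ : open J by case: pf => -[].
  have [osc_smooth null acc] := osc_curve_along fr oJ Ck_phi H.
  split=> // t Jt; rewrite acc //; have [Ip _ p0 _ _] := H t Jt.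
  apply: mulr_gt0; first exact: exprn_gt0.
  by rewrite exprn_even_gt0 //=; exact: k0.
exists (@ellipse_arc_form R); split=> [c cc|g c g0 cc].
  have [oc [I [a [k [fr k0]]]]] := curved_path_frame cc.
  have one := ellipse_arc_form_one_form oc fr.
  have arc := ellipse_arc_form_arc_element oc fr.
  split=> // J f tau' pf one' arc'.
  exact: arc_element_uniq pf one' one arc' (arc _ _ pf).
have [oc [I [a [k [fr k0]]]]] := curved_path_frame cc.
split; first exact: curved_path_mulmx.
move=> p v cp tv; have [u [s [Iu -> ->]]] := tangent_frame fr tv.
have gfr := centro_frame_mulmx g0 fr.
have [[[oI _] [ak _ _] _ _] _ _] := fr.1.
have da := @Ck_derivable _ _ 2 _ _ _ oI ak Iu.
have ogc := is_orientation_mulmx g0 oc.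
rewrite /pullback_linear (ellipse_arc_formE oc fr) // -scalemxAr.
by rewrite -(derive1_mulmx g da) (ellipse_arc_formE ogc gfr).
Qed.
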